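(* Let $F$ be the group of piecewise $PSL_2(\mathbb{Z})$ homeomorphisms of $\mathbb{R}$ with breakpoints in the set of rational numbers. Let $f:\mathbb{R}\to\mathbb{R}$, $f(t)=at+r$, where $a,r\in\mathbb{R}$, $a>0$, and if $a=1$ then $r\in\mathbb{R}\setminus\mathbb{Z}$. Then the group $\langle F,f\rangle$ of homeomorphisms of $\mathbb{R}$ generated by $F$ and $f$ admits a paradoxical decomposition with $25$ pieces.
   Context: A homeomorphism of $\mathbb{R}$ is piecewise $PSL_2(\mathbb{Z})$ with rational breakpoints if $\mathbb{R}$ can be divided at finitely many rational points into intervals such that on each of these intervals the homeomorphism coincides with a fractional linear map $t\mapsto \frac{pt+q}{kt+l}$ with $p,q,k,l\in\mathbb{Z}$, $pl-qk=1$. A paradoxical decomposition of a group $\Lambda$ consists of a partition of $\Lambda$ into pairwise disjoint subsets $S_1,\dots,S_n,T_1,\dots,T_m$ together with elements $s_1,\dots,s_n,t_1,\dots,t_m\in \Lambda$ such that $\Lambda=\bigcup_{1\le i\le n}s_iS_i=\bigcup_{1\le i\le m}t_iT_i$. The number of pieces is $n+m$. *)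

(* Defs.v *)
From HB Require Import structures.
From mathcomp Require Import all_boot all_order all_algebra.
From mathcomp Require Import all_classical all_reals.
From mathcomp Require Import topology normedtype.

Set Implicit Arguments.
Unset Strict Implicit.
Unset Printing Implicit Defensive.

Import Order.TTheory GRing.Theory Num.Theory.
Import numFieldNormedType.Exports.

Local Open Scope classical_set_scope.
Local Open Scope ring_scope.

(* [homeo T] is a group for composition: [(f * g)%g t = f (g t)]. *)
Record homeo (T : topologicalType) := Homeo {
  homeo_fun :> T -> T;
  homeo_inv : T -> T;
  homeo_funK : cancel homeo_fun homeo_inv;
  homeo_invK : cancel homeo_inv homeo_fun;
  homeo_continuous : continuous homeo_fun;
  homeo_inv_continuous : continuous homeo_inv }.

HB.instance Definition _ (T : topologicalType) := gen_eqMixin (homeo T).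
HB.instance Definition _ (T : topologicalType) := gen_choiceMixin (homeo T).

Section HomeoGroup.
Variable T : topologicalType.
Implicit Types f g h : homeo T.

Lemma homeo_ext f g : f =1 g -> f = g.
Proof.
case: f g => [f f' fK f'K cf cf'] [g g' gK g'K cg cg'] /= /funext fg.
subst g; have f'g' : f' = g'.
  by apply/funext => x; rewrite -[in LHS](g'K x) fK.
by subst g'; congr Homeo; exact: Prop_irrelevance.
Qed.

Definition homeo_one : homeo T :=
  @Homeo T id id (fun=> erefl) (fun=> erefl)
    (fun x => @cvg_id _ (nbhs x)) (fun x => @cvg_id _ (nbhs x)).

Definition homeo_mul f g : homeo T :=
  @Homeo T (f \o g) (homeo_inv g \o homeo_inv f)
    (can_comp (@homeo_funK _ f) (@homeo_funK _ g))
    (can_comp (@homeo_invK _ g) (@homeo_invK _ f))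
    (fun x => continuous_comp (@homeo_continuous _ g x)
                              (@homeo_continuous _ f (g x)))
    (fun x => continuous_comp
                (@homeo_inv_continuous _ f x)
                (@homeo_inv_continuous _ g (homeo_inv f x))).

Definition homeo_invg f : homeo T :=
  Homeo (@homeo_invK _ f) (@homeo_funK _ f)
        (@homeo_inv_continuous _ f) (@homeo_continuous _ f).

Lemma homeo_mulA : associative homeo_mul.
Proof. by move=> f g h; apply: homeo_ext. Qed.

Lemma homeo_mul1 : left_id homeo_one homeo_mul.
Proof. by move=> f; apply: homeo_ext. Qed.

Lemma homeo_mulr1 : right_id homeo_one homeo_mul.
Proof. by move=> f; apply: homeo_ext. Qed.

Lemma homeo_mulV : left_inverse homeo_one homeo_invg homeo_mul.
Proof. by move=> f; apply: homeo_ext => x /=; exact: homeo_funK. Qed.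

Lemma homeo_mulrV : right_inverse homeo_one homeo_invg homeo_mul.
Proof. by move=> f; apply: homeo_ext => x /=; exact: homeo_invK. Qed.

HB.instance Definition _ := isGroup.Build (homeo T)
  homeo_mulA homeo_mul1 homeo_mulr1 homeo_mulV homeo_mulrV.

End HomeoGroup.

Definition generated_subgroup (G : groupType) (A : set G) : set G :=
  smallest (fun H : set G => group_closed [in H]) A.

(* The nonemptiness of the pieces is part of the library notion [partition]. *)
Definition paradoxical_decomposition (G : groupType) (L : set G) (n m : nat)
    (S : 'I_n -> set G) (T : 'I_m -> set G) (s : 'I_n -> G) (t : 'I_m -> G) :=
  [/\ partition [set: 'I_n + 'I_m]
        (fun k => match k with inl i => S i | inr j => T j end) L,
      (forall i, L (s i)) /\ (forall j, L (t j)),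
      L = \bigcup_(i in [set: 'I_n]) ((fun x => (s i * x)%g) @` S i) &
      L = \bigcup_(j in [set: 'I_m]) ((fun x => (t j * x)%g) @` T j)].

Definition has_paradoxical_decomposition (G : groupType) (L : set G) (N : nat) :=
  exists n m (S : 'I_n -> set G) (T : 'I_m -> set G)
         (s : 'I_n -> G) (t : 'I_m -> G),
    (n + m)%N = N /\ paradoxical_decomposition L S T s t.

(* For an increasing [b] of size N, the closed intervals of index 0, ..., N are
   ]-oo, b_0], [b_0, b_1], ..., [b_(N-1), +oo[, and ]-oo, +oo[ if N = 0. *)
Definition subdivision_itv (R : realType) (b : seq rat) (i : nat) : interval R :=
  Interval (if i is j.+1 then BLeft (ratr b`_j) else -oo%O)
           (if (i < size b)%N then BRight (ratr b`_i) else +oo%O).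

Definition PSL2Z_on (R : realType) (h : R -> R) (I : set R) :=
  exists p q k l : int, p * l - q * k = 1 /\
    forall t, I t -> k%:~R * t + l%:~R != 0 /\
                     h t = (p%:~R * t + q%:~R) / (k%:~R * t + l%:~R).

Definition piecewise_PSL2Z (R : realType) (h : R -> R) :=
  exists b : seq rat, sorted <%O b /\
    forall i, (i <= size b)%N -> PSL2Z_on h [set` subdivision_itv R b i].

Definition F_PSL2Z (R : realType) : set (homeo R) :=
  [set h : homeo R | piecewise_PSL2Z h].
Arguments F_PSL2Z R : clear implicits.

Lemma affine_homeo_exists (R : realType) (a r : R) : 0 < a ->
  exists f : homeo R, forall t, f t = a * t + r.
Proof.
move=> a0; have an0 : a != 0 by rewrite gt_eqF.
have fK : cancel (fun t => a * t + r) (fun t => a^-1 * (t - r)).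
  by move=> t /=; rewrite addrK mulKf.
have gK : cancel (fun t => a^-1 * (t - r)) (fun t => a * t + r).
  by move=> t /=; rewrite mulVKf// subrK.
have cf : continuous (fun t : R => a * t + r).
  by move=> t; apply: cvgD; [apply: cvgM; [exact: cvg_cst|exact: cvg_id]|exact: cvg_cst].
have cg : continuous (fun t : R => a^-1 * (t - r)).
  by move=> t; apply: cvgM; [exact: cvg_cst|apply: cvgB; [exact: cvg_id|exact: cvg_cst]].
by exists (Homeo fK gK cf cg).
Qed.

(* Main.v *)
Require Import Defs.
From mathcomp Require Import all_boot all_order all_algebra.
From mathcomp Require Import finmap.
From mathcomp Require Import all_classical all_reals.
From mathcomp Require Import topology normedtype realfun.
From mathcomp Require Import complex.
From mathcomp Require Import zify ring lra.

Import Order.TTheory GRing.Theory Num.Theory.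
Import numFieldNormedType.Exports.

Local Open Scope classical_set_scope.
Local Open Scope ring_scope.

(** The group L = <F, f> contains, for some small z > 0, elements x_1, x_2, x_3
that agree on [1, 2] with the parabolic Moebius maps of parameter z fixing the
points oo, 0 and -1. They are close to the identity and expand lengths there,
and the words x_i x_j^-1 x_k x_l^-1 ... with distinct neighbouring indices are
never the identity. These facts make L non-amenable with explicit constants.

Expansion. Let A be a finite set of homeomorphisms of the line and XA the set
of all x_i g with g in A. Cut the line at the points that elements of A send to
the ends of [1, 23/12]. On a piece I, join g in A to x_i g in XA, as vertices of
a bipartite graph, when g maps I into [1, 23/12]. A cycle would give a closed
word in the x_i fixing an interval pointwise, so the graph is a forest. Weigh g
by the length of the part of g(I) in [1, 2] and an edge by the length of g(I);
an edge weighs no more than either of its ends, so in a forest the total weight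
of the edges is at most that of the vertices ([forest_weight]). Summing over the
pieces, every g in A contributes 3 * 11/12 on the left and every vertex at most
1 on the right, so 7 |A| <= 4 |XA| ([translates_expand]). Doing this twice gives
3 |A| <= |X X A|.

Hall's theorem then gives an injection Phi of three copies of the group into
itself, with Phi (g, c) = x_i x_j g. The images of the first two copies are
disjoint, and each is carried back onto the whole group by left multiplying its
parts with at most nine elements (x_i x_j)^-1; the image of the third copy
provides the elements that make all the 12 + 13 pieces nonempty
([paradoxical_of_injection]).

Freeness. The coefficients of a word are integer polynomials in z. A ping-pong
on degrees shows that a suitable coefficient, which vanishes for scalar
matrices, has leading coefficient 1 or -1; a ping-pong on absolute values shows
that its complex roots have modulus less than 6. Call z [generic] if it is a
root of no such polynomial. A rational number in ]0, 1[ is generic by the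
rational root theorem. If t is irrational, m + n t is generic once it is small
and n is large: if t is algebraic with a conjugate t' <> t, then m + n t' has
large modulus ([lincomb_small_generic]).

Realization. F contains maps that agree with t |-> -1/t on any prescribed
compact interval avoiding 0. So the three parabolic maps of parameter z are
realized on [1, 2] as soon as L realizes t |-> t + z on every bounded interval.
The set of such z is an additive group containing 1. If a <> 1 it contains all
powers of a, and if a = 1 it contains r. When this does not yield an irrational
number, either a is rational and its powers (or those of its inverse) are small
and rational, or r is rational with denominator q > 1, and then t |-> q^2 t is
locally a product of inversions and of translations by 1/q and q, so that 1/q
can be divided by any power of q^2. *)

Set Implicit Arguments.
Unset Strict Implicit.
Unset Printing Implicit Defensive.

(** * The marriage theorem for an infinite family of finite sets *)

Section Hall.
Local Open Scope fset_scope.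
Variables (I T : choiceType) (X : I -> {fset T}).

Let avail (D : set (I * T)) i := [fset x in X i | `[< ~ D (i, x) >]].
Let nbh D (A : {fset I}) := \bigcup_(i <- A) avail D i.
Let hall D := forall A : {fset I}, (#|` A| <= #|` nbh D A|)%N.

Let availP D i x : reflect (x \in X i /\ ~ D (i, x)) (x \in avail D i).
Proof. by rewrite !inE; apply: (iffP andP) => -[? /asboolP ?]. Qed.

Let nbhP D (A : {fset I}) x : reflect (exists2 i, i \in A & x \in avail D i) (x \in nbh D A).
Proof.
apply: (iffP (bigfcupP _ _ _ _)) => -[k]; first by rewrite andbT; exists k.
by move=> kA xk; exists k => //; rewrite andbT.
Qed.

Let nbhU D A B : nbh D (A `|` B) = nbh D A `|` nbh D B.
Proof.
apply/fsetP => x; rewrite in_fsetU; apply/nbhP/orP.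
  by move=> [k]; rewrite in_fsetU => /orP[] kA xk; [left|right]; apply/nbhP; exists k.
by move=> [] /nbhP[i iA xi]; exists i; rewrite // in_fsetU iA ?orbT.
Qed.

Let nbhI D A B : nbh D (A `&` B) `<=` nbh D A `&` nbh D B.
Proof.
apply/fsubsetP => x /nbhP[k]; rewrite in_fsetI => /andP[kA kB] xk.
by rewrite in_fsetI; apply/andP; split; apply/nbhP; exists k.
Qed.

(* A finite set of indices only involves finitely many pairs, and finitely many
   removed pairs of the union were already removed in one member of the chain. *)
Let hall_chain (F : set (set (I * T))) : (F `<=` hall)%classic ->
  total_on F subset -> hall set0 -> hall (\bigcup_(D in F) D)%classic.
Proof.
move=> Fh Ftot h0 A.
have chain (s : seq (I * T)) : (forall p, p \in s -> (\bigcup_(D in F) D)%classic p) ->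
    s = [::] \/ exists2 D, F D & forall p, p \in s -> D p.
  elim: s => [|p s IH] sF; [by left|right].
  have [D FD Dp] := sF p (mem_head _ _).
  case: IH => [q qs|->|[D' FD' D's]]; first by apply: sF; rewrite in_cons qs orbT.
    by exists D => // q; rewrite inE => /eqP ->.
  case: (Ftot _ _ FD FD') => sub; [exists D' => // q|exists D => // q];
    rewrite in_cons => /orP[/eqP ->|/D's] //; first exact: sub.
  exact: sub.
pose U := (\bigcup_(D in F) D)%classic.
pose s := [seq p <- [seq (i, x) | i <- A, x <- X i] | `[< U p >]].
have sP i x : i \in A -> x \in X i -> U (i, x) -> (i, x) \in s.
  move=> iA xi Ux; rewrite mem_filter asboolT//=.
  by apply/allpairsPdep; exists i, x.
suff [D hD DU] : exists2 D, hall D &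
    forall i x, i \in A -> x \in X i -> U (i, x) -> D (i, x).
  apply: (leq_trans (hD A)); apply: fsubset_leq_card.
  apply/fsubsetP => x /nbhP[i iA /availP[xi nD]]; apply/nbhP; exists i => //.
  by apply/availP; split=> // /(DU _ _ iA xi).
case: (chain s) => [p|s0|[D FD Ds]].
- by rewrite mem_filter => /andP[/asboolP ? _].
- by exists set0 => // i x iA xi Ux; move: (sP i x iA xi Ux); rewrite s0.
- by exists D => [|i x iA xi Ux]; [exact: Fh|apply: Ds; exact: sP].
Qed.

(** Rado's argument: remove as many pairs (i, x) with [x \in X i] as Hall's
condition allows. If two points remained available at i, removing either one
would violate the condition, on sets i |` A and i |` B; comparing the counts for
A `|` B and A `&` B shows that the condition already failed. Removing pairs
instead of extending partial matchings makes finite and infinite families alike,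
since Hall's condition passes to unions of chains. *)
Lemma hall_marriage :
  (forall A : {fset I}, (#|` A| <= #|` \bigcup_(i <- A) X i|)%N) ->
  exists2 phi : I -> T, injective phi & forall i, phi i \in X i.
Proof.
move=> HX.
have h0 : hall set0.
  move=> A; apply: leq_trans (HX A) _; apply: fsubset_leq_card.
  apply/fsubsetP => x /bigfcupP[k]; rewrite andbT => kA xk.
  by apply/nbhP; exists k => //; apply/availP; split=> // -[].
have [|D [hD maxD]] := @Zorn_bigcup (I * T)%type hall.
  by move=> F Fh Ftot; exact: hall_chain.
have uniq_avail i x y : x \in avail D i -> y \in avail D i -> x = y.
  move=> xi yi; apply: contrapT => xy.
  have bad z : z \in avail D i -> exists2 A, i \notin A &
      (#|` nbh D A `|` (avail D i `\ z)| <= #|` A|)%N.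
    move=> zi; have /existsNP[A] : ~ hall (D `|` [set (i, z)])%classic.
      apply: maxD; split; first by move=> p; left.
      move=> sub; case/availP: zi => _; apply.
      by apply: sub; right.
    move=> /negP; rewrite -ltnNge => Alt.
    have nbhE B : (nbh D (B `\ i) `<=` nbh (D `|` [set (i, z)])%classic B).
      apply/fsubsetP => t /nbhP[j]; rewrite in_fsetD1 => /andP[ji jB] /availP[tj nD].
      apply/nbhP; exists j => //; apply/availP; split=> // -[//|[ji' _]].
      by rewrite ji' eqxx in ji.
    have [iA|iA] := boolP (i \in A); last first.
      have := hD A; rewrite leqNgt (leq_ltn_trans _ Alt)//.
      by apply: fsubset_leq_card; have := nbhE A; rewrite mem_fsetD1.
    exists (A `\ i); first by rewrite in_fsetD1 eqxx.
    have := Alt; rewrite (cardfsD1 i A) iA /= ltnS; apply: leq_trans.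
    apply: fsubset_leq_card; rewrite fsubUset nbhE/=.
    apply/fsubsetP => t; rewrite in_fsetD1 => /andP[tz /availP[ti nD]].
    apply/nbhP; exists i => //; apply/availP; split=> // -[//|[tz']].
    by rewrite tz' eqxx in tz.
  have [A iA cA] := bad x xi; have [B iB cB] := bad y yi.
  have : (#|` A `|` B|.+1 + #|` A `&` B| <= #|` A| + #|` B|)%N.
    apply: leq_trans (leq_add cA cB); rewrite -cardfsUI; apply: leq_add.
      have -> : (#|` A `|` B|.+1 = #|` i |` (A `|` B)|)%N.
        by rewrite cardfsU1 in_fsetU (negbTE iA) (negbTE iB).
      apply: leq_trans (hD _) _; apply: fsubset_leq_card; rewrite !nbhU.
      apply/fsubsetP => t; rewrite !in_fsetU => /or3P[|->|->]; rewrite ?orbT//.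
      move=> /nbhP[j]; rewrite in_fset1 => /eqP -> ti.
      rewrite !in_fsetD1 ti !andbT; case: eqVneq => [->|]; rewrite ?orbT//.
      by case: eqVneq => [/xy|] //; rewrite ?orbT.
    apply: leq_trans (hD _) _; apply: fsubset_leq_card.
    apply: fsubset_trans (nbhI _ _ _) _.
    by apply: fsetISS; exact: fsubsetUl.
  by rewrite addSn cardfsUI ltnn.
have ex i : {x | x \in avail D i}.
  apply: cid; have := hD [fset i]; rewrite cardfs1 cardfs_gt0.
  by case/fset0Pn => x /nbhP[j]; rewrite in_fset1 => /eqP ->; exists x.
exists (fun i => projT1 (ex i)) => [i j ij|i]; last first.
  by case: (ex i) => x /= /availP[].
apply: contrapT => nij; have := hD [fset i; j].
rewrite cardfs2; case: eqP => // _; suff : (#|` nbh D [fset i; j]| <= 1)%N.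
  by move=> h /leq_trans/(_ h); rewrite ltnn.
rewrite -(cardfs1 (projT1 (ex i))); apply/fsubset_leq_card/fsubsetP => t.
move=> /nbhP[k]; rewrite in_fset2 in_fset1 => /orP[]/eqP -> tk.
  by apply/eqP/(uniq_avail i) => //; case: (ex i).
by rewrite ij; apply/eqP/(uniq_avail j) => //; case: (ex j).
Qed.
End Hall.

(** * Words in three parabolic matrices *)

(** [None], [Some true] and [Some false] stand for the fixed points oo, 0 and -1
of the three parabolic matrices; any two of these cusps have determinant 1 or -1,
which is what makes the leading coefficients below units. *)
Definition cusp := option bool.

Section Words.
Variable K : comNzRingType.
Implicit Types (z : K) (v : K * K) (i l m s : cusp) (w : seq (cusp * cusp)).

(** The determinant, up to sign, of v with the vector of the cusp. *)
Definition cusp_form i v : K :=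
  match i with
  | None => v.2
  | Some true => v.1
  | Some false => v.1 + v.2
  end.

Definition parabolic z i v : K * K :=
  match i with
  | None => (v.1 + z * v.2, v.2)
  | Some true => (v.1, v.2 - z * v.1)
  | Some false => (v.1 + z * (v.1 + v.2), v.2 - z * (v.1 + v.2))
  end.

Definition cusp_vec i : K * K :=
  match i with
  | None => (1, 0)
  | Some true => (0, 1)
  | Some false => (1, -1)
  end.

(** A word is a list of pairs (i, j), each standing for the matrix
[parabolic z j]^-1 * [parabolic z i]; the head of the list acts first. *)
Definition run z w v := foldl (fun v p => parabolic (- z) p.2 (parabolic z p.1 v)) v w.

(** Neighbouring indices differ, s being the index that precedes the word. *)
Fixpoint reduced s w :=
  if w is p :: w' then [&& p.1 != s, p.2 != p.1 & reduced p.2 w'] else true.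

Lemma cusp_form_parabolic_id z i v : cusp_form i (parabolic z i v) = cusp_form i v.
Proof. by case: i => [[]|] //=; ring. Qed.

Lemma cusp_form_parabolic z l m v : l != m ->
  exists e : bool, cusp_form l (parabolic z m v) = cusp_form l v + (-1) ^+ e * (z * cusp_form m v).
Proof.
by case: l m => [[]|] [[]|] //= _;
  try (by exists false; rewrite /=; ring); exists true; rewrite /=; ring.
Qed.

Lemma cusp_form_vec_id s : cusp_form s (cusp_vec s) = 0.
Proof. by case: s => [[]|] /=; ring. Qed.

Lemma cusp_form_vec l s : l != s -> exists e : bool, cusp_form l (cusp_vec s) = (-1) ^+ e.
Proof.
by case: l s => [[]|] [[]|] //= _;
  try (by exists false; rewrite /=; ring); exists true; rewrite /=; ring.
Qed.

Lemma run_linear z w : exists a b c d, forall v,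
  run z w v = (a * v.1 + b * v.2, c * v.1 + d * v.2).
Proof.
have par_lin y i : exists a b c d, forall v,
  parabolic y i v = (a * v.1 + b * v.2, c * v.1 + d * v.2).
  case: i => [[]|] /=.
  - by exists 1, 0, (- y), 1 => v; congr pair; ring.
  - by exists (1 + y), y, (- y), (1 - y) => v; congr pair; ring.
  - by exists 1, y, 0, 1 => v; congr pair; ring.
elim: w => [|p w [a [b [c [d IH]]]]] /=.
  by exists 1, 0, 0, 1 => -[v1 v2] /=; congr pair; ring.
have [a1 [b1 [c1 [d1 E1]]]] := par_lin z p.1.
have [a2 [b2 [c2 [d2 E2]]]] := par_lin (- z) p.2.
pose A a' b' := a' * (a2 * a1 + b2 * c1) + b' * (c2 * a1 + d2 * c1).
pose B a' b' := a' * (a2 * b1 + b2 * d1) + b' * (c2 * b1 + d2 * d1).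
exists (A a b), (B a b), (A c d), (B c d) => v.
by rewrite IH E2 E1 /= /A /B; congr pair; ring.
Qed.

End Words.

Lemma rmorph_run (K K' : comNzRingType) (f : {rmorphism K -> K'}) z s w l :
  f (cusp_form l (run z w (cusp_vec K s))) = cusp_form l (run (f z) w (cusp_vec K' s)).
Proof.
pose g (v : K * K) := (f v.1, f v.2).
have gb : g (cusp_vec K s) = cusp_vec K' s.
  by case: s => [[]|] /=; rewrite /g /= ?rmorphN ?rmorph1 ?rmorph0.
have gp y i v : g (parabolic y i v) = parabolic (f y) i (g v).
  by case: i => [[]|] /=; rewrite /g /= ?rmorphB ?rmorphD ?rmorphM ?rmorphD.
have gl v : f (cusp_form l v) = cusp_form l (g v).
  by case: l => [[]|] //=; rewrite rmorphD.
rewrite gl -gb; congr cusp_form; elim: w (cusp_vec K s) => //= p w IH v.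
by rewrite IH !gp rmorphN.
Qed.

Section Degree.
Implicit Types (v : {poly int} * {poly int}) (s m l : cusp).

(** The ping-pong domains for the absolute value given by the degree: the form of
the last cusp used is dominated by the two others. *)
Definition deg_state s n v :=
  (size (cusp_form s v) <= n)%N /\
  forall l, l != s -> size (cusp_form l v) = n.+1 /\ `|lead_coef (cusp_form l v)| = 1.

Lemma deg_state_parabolic (b : bool) s m n v : m != s -> deg_state s n v ->
  deg_state m n.+1 (parabolic ((-1) ^+ b * 'X) m v).
Proof.
move=> ms [vs vl]; have [vm lm] := vl _ ms.
have vle l : (size (cusp_form l v) <= n.+1)%N.
  by have [->|/vl[->//]] := eqVneq l s; exact: leqW.
split; first by rewrite cusp_form_parabolic_id vm.
move=> l lm'; have [e ->] := cusp_form_parabolic ((-1) ^+ b * 'X) v lm'.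
have -> : (-1) ^+ e * ((-1) ^+ b * 'X * cusp_form m v) =
          ((-1) ^+ (e (+) b))%:P * (cusp_form m v * 'X) :> {poly int}.
  by rewrite signr_addb rmorphM !rmorphXn rmorphN1; ring.
have m0 : cusp_form m v != 0 by rewrite -size_poly_eq0 vm.
have u : (-1) ^+ (e (+) b) != 0 :> int by rewrite signr_eq0.
have sz : size (((-1) ^+ (e (+) b))%:P * (cusp_form m v * 'X)) = n.+2.
  by rewrite mul_polyC size_scale// size_mulX// vm.
have lt : (size (cusp_form l v) < size (((-1) ^+ (e (+) b))%:P * (cusp_form m v * 'X))%R)%N.
  by rewrite sz ltnS vle.
rewrite lead_coefDr// addrC size_polyDl// sz; split=> //.
by rewrite lead_coefM lead_coefC lead_coefMX normrM normrX normrN1 expr1n mul1r.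
Qed.

Lemma deg_state_run w s n v : reduced s w -> deg_state s n v ->
  exists n', deg_state (last s (map snd w)) n' (run 'X w v).
Proof.
elim: w s n v => [|[i j] w IH] s n v /=; first by exists n.
move=> /and3P[is_ ji redw] st.
apply: (IH _ n.+2 _ redw).
have := deg_state_parabolic true ji (deg_state_parabolic false is_ st).
by rewrite expr0 expr1 mul1r mulN1r.
Qed.

Lemma deg_state_vec s : deg_state s 0 (cusp_vec {poly int} s).
Proof.
split; first by rewrite cusp_form_vec_id size_poly0.
move=> l /(cusp_form_vec {poly int})[e ->]; rewrite -polyC1 -rmorphN -rmorphXn.
by rewrite size_polyC signr_eq0 lead_coefC normrX normrN1 expr1n.
Qed.
End Degree.

Section Modulus.
Variable C : numDomainType.
Implicit Types (z : C) (v : C * C) (s m l : cusp).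

(** The archimedean ping-pong domains. The factor 2 is stable as soon as the
modulus of z is at least 6, because |z| + 2 <= 2 (|z| - 2) from there on. *)
Definition norm_state s v :=
  (forall m, m != s -> cusp_form m v != 0) /\
  (forall l m, m != s -> `|cusp_form l v| <= `|cusp_form m v| *+ 2).

Lemma norm_state_parabolic z s m v : 6 <= `|z| -> m != s -> norm_state s v ->
  norm_state m (parabolic z m v).
Proof.
move=> z6 ms [v0 vle]; set x := `|cusp_form m v|.
have x0 : 0 < x by rewrite normr_gt0 v0.
have zx : x *+ 6 <= `|z| * x by rewrite -mulr_natl ler_pM2r.
have lo l : l != m -> `|z| * x - x *+ 2 <= `|cusp_form l (parabolic z m v)|.
  move=> lm; have [e ->] := cusp_form_parabolic z v lm.
  rewrite [cusp_form l v + _]addrC; apply: le_trans (lerB_normD _ _).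
  by rewrite !normrM normrX normrN1 expr1n mul1r lerD2l lerN2 vle.
have up l : `|cusp_form l (parabolic z m v)| <= `|z| * x + x *+ 2.
  have [->|lm] := eqVneq l m.
    rewrite cusp_form_parabolic_id -/x; apply: le_trans (_ : x *+ 2 <= _).
      by rewrite mulr2n lerDl ltW.
    by rewrite lerDr mulr_ge0// ltW.
  have [e ->] := cusp_form_parabolic z v lm; rewrite [cusp_form l v + _]addrC.
  apply: le_trans (ler_normD _ _) _.
  by rewrite !normrM normrX normrN1 expr1n mul1r lerD2l vle.
split=> [l lm|l l' l'm].
  rewrite -normr_gt0; apply: lt_le_trans (lo _ lm).
  by rewrite subr_gt0; apply: lt_le_trans zx; rewrite ltr_pMn2l.
apply: le_trans (up l) _; apply: le_trans (_ : (`|z| * x - x *+ 2) *+ 2 <= _).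
  rewrite -subr_ge0; have -> : (`|z| * x - x *+ 2) *+ 2 - (`|z| * x + x *+ 2) =
    `|z| * x - x *+ 6 by ring.
  by rewrite subr_ge0.
by rewrite lerMn2r lo.
Qed.

Lemma norm_state_run z w s v : 6 <= `|z| -> reduced s w -> norm_state s v ->
  norm_state (last s (map snd w)) (run z w v).
Proof.
move=> z6; elim: w s v => [|[i j] w IH] s v //= /and3P[is_ ji redw] st.
by apply: IH => //; apply: norm_state_parabolic ji _; [rewrite normrN|exact: norm_state_parabolic is_ st].
Qed.

Lemma norm_state_vec s : norm_state s (cusp_vec C s).
Proof.
split=> [m /(cusp_form_vec C)[e ->]|l m /(cusp_form_vec C)[e ->]]; first by rewrite signr_eq0.
rewrite normrX normrN1 expr1n; have [->|/(cusp_form_vec C)[e' ->]] := eqVneq l s.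
  by rewrite cusp_form_vec_id normr0 ler0n.
by rewrite normrX normrN1 expr1n ler1n.
Qed.
End Modulus.

(** The entries that [cusp_form] reads off a reduced word are polynomials of this
kind, by [deg_state_run] and [norm_state_run]. *)
Definition generic (R : realType) (z : R) := forall Q : {poly int},
  `|lead_coef Q| = 1 ->
  (forall c : R[i], root (map_poly intr Q) c -> `|c| < 6%:R) ->
  ~~ root (map_poly intr Q) z.

(** The form vanishes on the vector of its own cusp, hence would also vanish after
applying a scalar word. The word is evaluated first at the indeterminate over
the integers, then specialized at z and at the complex roots. *)
Lemma cusp_form_run_neq0 (R : realType) (z : R) s w : generic z ->
  reduced s w -> last s (map snd w) != s -> cusp_form s (run z w (cusp_vec R s)) != 0.
Proof.
move=> gz redw ls; pose Q := cusp_form s (run 'X w (cusp_vec {poly int} s)).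
have evalQ (K : comNzRingType) (c : K) :
    (map_poly intr Q).[c] = cusp_form s (run c w (cusp_vec K s)).
  have -> : map_poly intr Q = cusp_form s (run 'X w (cusp_vec {poly K} s)).
    by have := @rmorph_run _ _ (map_poly (intr : int -> K)) 'X s w s; rewrite /= map_polyX.
  have := @rmorph_run _ _ (horner_eval c) 'X s w s.
  by rewrite /= /horner_eval hornerX.
rewrite -evalQ; apply: gz.
  have [n [_ /(_ s)]] := deg_state_run redw (deg_state_vec s).
  by rewrite eq_sym => /(_ ls)[].
move=> c rc; have := rc; rewrite /root evalQ; rewrite real_ltNge ?normr_real//.
by apply: contraL => c6; have [] := norm_state_run c6 redw (norm_state_vec _ s);
  move=> + _; apply; rewrite eq_sym.
Qed.

(** Three fixed directions make a 2 x 2 matrix scalar. The cusp s in the proof has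
to differ from both ends of the word, hence the need for three cusps. *)
Lemma run_not_scalar (R : realType) (z : R) i w : generic z -> w != [::] ->
  reduced i w -> forall t1 t2 t3 : R, t1 < t2 -> t2 < t3 ->
  ~ (forall t, t \in [:: t1; t2; t3] -> exists k, run z w (t, 1) = (k * t, k)).
Proof.
move=> gz w0 redw t1 t2 t3 t12 t23 fixt.
have [s /andP[s1 s2]] : exists s : cusp, (s != (head (i, i) w).1) && (s != last i (map snd w)).
  case: (head _ _).1 (last _ _) => [[]|] [[]|]; by [exists None|exists (Some true)|exists (Some false)].
have redw' : reduced s w.
  by case: w redw {w0 fixt s2} s1 => //= p w /and3P[_ -> ->]; rewrite eq_sym => ->.
have lw : last s (map snd w) = last i (map snd w) by case: w w0 {redw redw' fixt s1 s2}.
have := cusp_form_run_neq0 gz redw'; rewrite lw eq_sym => /(_ s2)/negP; apply.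
have [a [b [c [d E]]]] := run_linear z w.
have P t : t \in [:: t1; t2; t3] -> a * t + b = (c * t + d) * t.
  by move=> /fixt[k]; rewrite E /= !mulr1 => -[-> ->].
have P1 := P _ (mem_head _ _).
have P2 := P t2 _; have {}P2 := P2 ltac:(by rewrite !inE eqxx orbT).
have P3 := P t3 _; have {}P3 := P3 ltac:(by rewrite !inE eqxx !orbT).
have n12 : t2 - t1 != 0 by rewrite subr_eq0 gt_eqF.
have n13 : t3 - t1 != 0 by rewrite subr_eq0 gt_eqF// (lt_trans t12).
have n23 : t3 - t2 != 0 by rewrite subr_eq0 gt_eqF.
have c0 : c = 0.
  apply: (mulIf n12); apply: (mulIf n13); apply: (mulIf n23); rewrite !mul0r.
  have -> : c * (t2 - t1) * (t3 - t1) * (t3 - t2) =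
    ((c * t1 + d) * t1 - (a * t1 + b)) * (t3 - t2)
    - ((c * t2 + d) * t2 - (a * t2 + b)) * (t3 - t1)
    + ((c * t3 + d) * t3 - (a * t3 + b)) * (t2 - t1) by ring.
  by rewrite P1 P2 P3; ring.
have ad : a = d.
  apply: (mulIf n12); move: P1 P2; rewrite c0 => P1 P2.
  have -> : a * (t2 - t1) = (a * t2 + b) - (a * t1 + b) by ring.
  by rewrite P1 P2; ring.
have b0 : b = 0 by move: P1; rewrite c0 ad; lra.
rewrite E b0 c0 ad; apply/eqP; case: (s) => [[]|] /=; ring.
Qed.

(** * Small real numbers that are generic *)

(** By Gauss's lemma the minimal polynomial of x divides the given polynomial over
the integers, so its leading coefficient is a unit and x would be an integer. *)
Lemma generic_rat (R : realType) (x : rat) : 0 < x < 1 -> generic (ratr x : R).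
Proof.
move=> /andP[x0 x1] Q lQ _; apply/negP.
have -> : map_poly (intr : int -> R) Q = map_poly ratr (map_poly (intr : int -> rat) Q).
  by rewrite -map_poly_comp; apply: eq_map_poly => n /=; rewrite ratr_int.
rewrite fmorph_root root_factor_theorem => /dvdpP_rat_int[p1 [a a0 E] [q Qq]].
have sz : size p1 = 2%N.
  by have := size_XsubC x; rewrite E size_scale// size_rat_int_poly.
have /eqP l1 : absz (p1`_1) == 1%N.
  have := lQ; rewrite Qq lead_coefM normrM -!abszE => -[/eqP].
  by rewrite muln_eq1 => /andP[+ _]; rewrite lead_coefE sz.
have /(congr1 (fun p : {poly rat} => p`_0)) := E.
have /(congr1 (fun p : {poly rat} => p`_1)) := E.
rewrite !coefZ !coef_map !coefB !coefX !coefC /= subr0 sub0r => a1 xE.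
have sgn : p1`_1 * p1`_1 = 1 by have := congr1 Posz l1; lia.
have xint : x = (- p1`_0 * p1`_1)%:~R.
  have aE : a = (p1`_1)%:~R by rewrite -[LHS]mulr1 -[1 in LHS](rmorph1 intr) -sgn rmorphM mulrA -a1 mul1r.
  by rewrite -[LHS]opprK xE aE -rmorphM -rmorphN; congr (_%:~R); ring.
by move: x0 x1; rewrite xint ltr0z ltrz1; lia.
Qed.

Definition irrational (R : realType) (t : R) := forall x : rat, t <> ratr x.

(** The polynomial M of least degree killing t has t as a simple root, since the
derivative of M does not kill t. As t is irrational the degree of M is at least
two, so M has a complex root other than t. *)
Lemma algebraic_irrational_conjugate (R : realType) (t : R) : irrational t ->
  (exists2 P : {poly rat}, P != 0 & root (map_poly ratr P) t) ->
  exists2 c : R[i], c != real_complex R t & forall P : {poly rat},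
    root (map_poly ratr P) t -> root (map_poly ratr P) c.
Proof.
move=> irr [P0 P0n0 P0t].
pose kills n := `[< exists2 P : {poly rat}, P != 0 & root (map_poly ratr P) t /\ size P = n >].
have [|n /asboolP[M M0 [Mt Mn]] minM] := @ex_minnP kills.
  by exists (size P0); apply/asboolP; exists P0.
have minP (P : {poly rat}) : root (map_poly ratr P) t -> (size P < size M)%N -> P = 0.
  move=> Pt; rewrite Mn => Pn; apply/eqP/negPn/negP => P0'.
  by move: Pn; rewrite ltnNge minM//; apply/asboolP; exists P.
have dvdM (P : {poly rat}) : root (map_poly ratr P) t -> M %| P.
  move=> Pt; apply/eqP/minP; last by rewrite ltn_modp.
  have := Pt; rewrite [in X in X -> _](divp_eq P M) rmorphD rmorphM /= /root.
  by rewrite hornerD hornerM (eqP Mt) mulr0 add0r.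
have ratrC (P : {poly rat}) : map_poly ratr P = map_poly (real_complex R) (map_poly ratr P).
  by rewrite -map_poly_comp; apply: eq_map_poly => x /=; rewrite fmorph_rat.
have MCt : root (map_poly ratr M) (real_complex R t) by rewrite ratrC fmorph_root.
have szM : (2 < size M)%N.
  rewrite ltnNge; apply/negP => sz2.
  have := Mt; rewrite /root horner_coef size_map_poly.
  have M1 : (1 < size M)%N.
    by rewrite -(size_map_poly (@ratr R)); apply: root_size_gt1 Mt; rewrite map_poly_eq0.
  have -> : size M = 2%N by apply/eqP; rewrite eqn_leq sz2.
  rewrite !big_ord_recl big_ord0 /= !coef_map expr0 expr1 mulr1 addr0 /=.
  have c1 : M`_1 != 0 by have := lead_coef_eq0 M; rewrite lead_coefE (_ : size M = 2%N) => [->|]; last by apply/eqP; rewrite eqn_leq sz2.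
  rewrite addr_eq0 => /eqP e; apply: (irr (- M`_0 / M`_1)).
  by rewrite rmorphM fmorphV rmorphN /= e opprK mulrAC divff ?mul1r// fmorph_eq0.
have := MCt; rewrite root_factor_theorem => /dvdpP[q qE].
have q0 : q != 0.
  by apply: contraNneq M0 => q0; rewrite -(map_poly_eq0 (@ratr R[i])) qE q0 mul0r.
have /closed_rootP[c qc] : size q != 1%N.
  have := size_map_poly (@ratr R[i]) M.
  by rewrite qE size_mul ?polyXsubC_eq0// size_XsubC addn2 /= => E; move: szM; rewrite -E; case: (size q) => [|[]].
exists c => [|P /dvdM/dvdpP[S ->]]; last first.
  by rewrite rmorphM /= /root hornerM qE hornerM (eqP qc) mul0r mulr0.
apply/eqP => ct; have dM0 : M^`() != 0.
  apply/eqP => /(congr1 (fun p : {poly rat} => p`_(size M).-2)).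
  rewrite coef_deriv coef0 (_ : (size M).-2.+1 = (size M).-1); last by move: szM; lia.
  by apply/eqP; rewrite mulrn_eq0 -lead_coefE lead_coef_eq0 negb_or M0 andbT; lia.
have : M^`() = 0.
  apply: minP; last by rewrite lt_size_deriv.
  rewrite -(fmorph_root (real_complex R)) -ratrC -deriv_map /= qE derivM derivXsubC.
  by rewrite /root !hornerE /= subrr mulr0 add0r -ct.
by move/eqP; rewrite (negbTE dM0).
Qed.

Section SmallTranslations.
Variables (R : realType) (t : R).

(** For a fixed n the positive values of m + n t are bounded below by the
fractional part of n t, or by 1 when this part is 0. Used the other way round:
a combination that is small enough has a large coefficient n. *)
Lemma lincomb_lower_bound (N : nat) : exists2 d : R, 0 < d &
  forall m n : int, (`|n| <= N)%N -> 0 < m%:~R + n%:~R * t -> d <= m%:~R + n%:~R * t.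
Proof.
have one (n : int) : exists2 d : R, 0 < d &
    forall m : int, 0 < m%:~R + n%:~R * t -> d <= m%:~R + n%:~R * t.
  set y := n%:~R * t; pose e := y - (Num.floor y)%:~R.
  have e0 : 0 <= e by rewrite subr_ge0 floor_le_tmp.
  have e1 : e < 1 by rewrite ltrBlDl -intrD1 floorD1_gt.
  have yE m : m%:~R + y = (m + Num.floor y)%:~R + e by rewrite intrD /e; ring.
  exists (if 0 < e then e else 1); first by case: ifP.
  move=> m; rewrite yE; set k := m + _ => pos.
  have k0 : 0 <= k.
    have : (-1)%:~R < k%:~R :> R by rewrite intrN; lra.
    by rewrite ltr_int; lia.
  case: ifPn => [_|]; first by rewrite lerDr ler0z.
  rewrite -leNgt => e0'; have {}e0 : e = 0 by apply/le_anti/andP.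
  by move: pos; rewrite e0 !addr0 ltr0z ler1z.
elim: N => [|N [d d0 dP]].
  have [d d0 dP] := one 0; exists d => // m n; rewrite leqn0 absz_eq0 => /eqP ->.
  exact: dP.
have [d1 d10 d1P] := one N.+1; have [d2 d20 d2P] := one (- N.+1%:Z).
exists (Num.min d (Num.min d1 d2)); first by rewrite !lt_min d0 d10.
move=> m n nN pos; rewrite !ge_min.
have [nN'|nN'] := leqP `|n| N; first by rewrite dP.
have [e|e] : n = N.+1 \/ n = - N.+1%:Z by lia.
  by rewrite e in pos *; rewrite d1P ?orbT.
by rewrite e in pos *; rewrite d2P ?orbT.
Qed.

Hypothesis irr : irrational t.

Lemma lincomb_int_neq0 (m n : int) : n != 0 -> m%:~R + n%:~R * t != 0.
Proof.
move=> n0; rewrite addrC addr_eq0; apply/eqP => e.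
have n0' : n%:~R != 0 :> R by rewrite intr_eq0.
apply: (irr (x := - m%:~R / n%:~R)).
by rewrite rmorphM fmorphV rmorphN /= !ratr_int -e mulrAC divff ?mul1r.
Qed.

(** Dividing 1 by a combination p in ]0, 1[ leaves a nonzero remainder e < p; one of
e and p - e is at most p / 2. *)
Lemma lincomb_small (eps : R) : 0 < eps ->
  exists m n : int, 0 < m%:~R + n%:~R * t < eps.
Proof.
move=> eps0.
suff half k : exists m n : int, 0 < m%:~R + n%:~R * t < 1 /\
    m%:~R + n%:~R * t <= 2^-1 ^+ k.
  have [m [n [/andP[p0 _] ple]]] := half (Num.truncn eps^-1).+1.
  exists m, n; rewrite p0 /=; apply: le_lt_trans ple _.
  rewrite exprVn invf_plt ?posrE ?exprn_gt0//.
  apply: lt_trans (truncnS_gt _) _.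
  by rewrite -natrX ltr_nat ltn_expl.
elim: k => [|k [m [n [/andP[p0 p1] ple]]]].
  exists (- Num.floor t), 1; rewrite expr0 mul1r intrN addrC.
  have e1 : t - (Num.floor t)%:~R < 1 by rewrite ltrBlDl -intrD1 floorD1_gt.
  rewrite e1 ltW// andbT subr_gt0 lt_neqAle floor_le_tmp andbT; split=> //.
  apply/eqP => e; apply: (irr (x := (Num.floor t)%:~R)).
  by rewrite ratr_int.
set p := _ + _ in p0 p1 ple.
pose j := Num.floor p^-1; pose e := 1 - j%:~R * p.
have eE : e = (1 - j * m)%:~R + (- j * n)%:~R * t by rewrite /e /p !(intrD, intrM, intrN); ring.
have n0 : n != 0.
  apply/negP => /eqP n0; move: p0 p1; rewrite /p n0 mul0r addr0 ltr0z ltrz1; lia.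
have e0 : 0 <= e.
  by rewrite subr_ge0 -ler_pdivlMr// mul1r floor_le_tmp.
have ep : e < p.
  rewrite ltrBlDl -{2}[p]mul1r -mulrDl -ltr_pdivrMr// mul1r -intrD1 floorD1_gt//.
have j1 : 1 <= j.
  by rewrite /j real_floor_ge_int ?num_real// invf_ge1// ltW.
have e0' : e != 0 by rewrite eE lincomb_int_neq0// mulf_neq0// oppr_eq0; lia.
have {}e0 : 0 < e by rewrite lt_neqAle eq_sym e0'.
have pk : p / 2 <= 2^-1 ^+ k.+1 by rewrite exprS mulrC ler_pM2l// invr_gt0.
have [le|lt] := leP e (p / 2).
  exists (1 - j * m), (- j * n); rewrite -eE e0 (lt_trans ep)//; split=> //.
  exact: le_trans pk.
exists (m - (1 - j * m)), (n - (- j * n)).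
have -> : (m - (1 - j * m))%:~R + (n - - j * n)%:~R * t = p - e.
  by rewrite eE /p !(intrD, intrM, intrN); ring.
split; first by apply/andP; split; lra.
apply: le_trans pk; lra.
Qed.

(** If t is transcendental, so is m + n t, which is then no root of a nonzero
integer polynomial. Otherwise such a root would give the root m + n c with c a
conjugate of t, and |m + n c| >= |n| |c - t| - |m + n t| exceeds 6 for large n. *)
Lemma lincomb_small_generic (eps : R) : 0 < eps ->
  exists m n : int, 0 < m%:~R + n%:~R * t < eps /\ generic (m%:~R + n%:~R * t).
Proof.
move=> eps0.
pose alg := exists2 P : {poly rat}, P != 0 & root (map_poly ratr P) t.
pose L m n (Q : {poly int}) : {poly rat} :=
  map_poly intr Q \Po (m%:~R%:P + n%:~R *: 'X).
have LE (K : numFieldType) (m n : int) (Q : {poly int}) (c : K) :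
    (map_poly ratr (L m n Q)).[c] = (map_poly intr Q).[m%:~R + n%:~R * c].
  rewrite map_comp_poly horner_comp; congr horner.
    by rewrite -map_poly_comp; apply: eq_map_poly => x /=; rewrite ratr_int.
  by rewrite rmorphD /= map_polyC map_polyZ map_polyX /= !hornerE !ratr_int.
have Lroot (m n : int) Q : root (map_poly intr Q) (m%:~R + n%:~R * t) ->
    root (map_poly ratr (L m n Q)) t by rewrite /root LE.
have [A|nA] := pselect alg; last first.
  have [m [n smn]] := @lincomb_small (Num.min eps 1) ltac:(by rewrite lt_min eps0 ltr01).
  exists m, n; split.
    by case/andP: smn => ->; rewrite lt_min => /andP[].
  have n0 : n != 0.
    apply/negP => /eqP n0; move: smn; rewrite n0 mul0r addr0 lt_min ltr0z ltrz1; lia.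
  move=> Q lQ _; apply/negP => /Lroot rQ; apply: nA; exists (L m n Q) => //.
  apply/eqP => /eqP; rewrite comp_poly_eq0; last first.
    by rewrite addrC size_polyDl size_scale ?intr_eq0// size_polyX// size_polyC; case: (_ != 0).
  rewrite -size_poly_eq0 size_rat_int_poly size_poly_eq0 => /eqP Q0.
  by move/eqP: lQ; rewrite Q0 lead_coef0 normr0.
have [c ct cP] := algebraic_irrational_conjugate irr A.
have [r r0 rE] : exists2 r : R, 0 < r & `|c - real_complex R t| = real_complex R r.
  have := normr_gt0 (c - real_complex R t); rewrite subr_eq0 ct normc_def ltcR => pos.
  by eexists; first exact: pos.
(* 7 = 6 + 1: the modulus to be exceeded plus a bound for m + n t. *)
pose N := (Num.truncn (7 / r)).+1.
have [d d0 dP] := lincomb_lower_bound N.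
have [m [n /andP[p0]]] := @lincomb_small (Num.min eps (Num.min 1 d)) ltac:(by rewrite !lt_min eps0 ltr01).
rewrite !lt_min => /and3P[peps p1 pd]; exists m, n; split; first by rewrite p0.
move=> Q _ rootQ; apply/negP => /Lroot/cP; rewrite /root LE => /rootQ.
have nN : (N < `|n|)%N by rewrite ltnNge; apply/negP => /dP/(_ p0); rewrite leNgt pd.
suff : 6%:R <= `|m%:~R + n%:~R * c| by move=> h /(le_lt_trans h); rewrite ltxx.
set p := m%:~R + n%:~R * t in p0 p1.
have -> : m%:~R + n%:~R * c = n%:~R * (c - real_complex R t) + real_complex R p.
  by rewrite /p rmorphD rmorphM /= !rmorph_int; ring.
apply: le_trans (lerB_normD _ _); rewrite normrM rE.
have -> : `|real_complex R p| = real_complex R p by apply: ger0_norm; rewrite lecR ltW.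
have -> : `|n%:~R| = real_complex R `|n|%N%:R :> R[i].
  by rewrite rmorph_nat natr_absz intr_norm.
rewrite -rmorphM -rmorphB -(rmorph_nat (real_complex R)) lecR.
have : 7 <= `|n|%N%:R * r.
  rewrite -ler_pdivrMr//; apply/ltW/(lt_le_trans (truncnS_gt _)).
  by rewrite ler_nat ltnW.
lra.
Qed.
End SmallTranslations.

(** * Weights on forests, and the parabolic maps near [1, 2] *)

(** The forest hypothesis is the existence, in every nonempty set of edges, of an
edge with an end that meets no other edge. Removing that edge together with
this end lowers the vertex side by at least the weight of the edge. *)
Lemma forest_weight (R : realDomainType) (E V : eqType) (l r : E -> V)
    (w : E -> R) (wl wr : V -> R) (S : seq E) (A B : seq V) :
  (forall S', S' != [::] -> {subset S' <= S} -> exists2 e, e \in S' &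
    (forall e', e' \in S' -> l e' = l e -> e' = e) \/
    (forall e', e' \in S' -> r e' = r e -> e' = e)) ->
  uniq S -> uniq A -> uniq B ->
  (forall e, e \in S -> [/\ l e \in A, r e \in B, w e <= wl (l e) & w e <= wr (r e)]) ->
  (forall v, 0 <= wl v) -> (forall v, 0 <= wr v) ->
  \sum_(e <- S) w e <= \sum_(v <- A) wl v + \sum_(v <- B) wr v.
Proof.
move=> + + + + + wl0 wr0.
elim: {S}(size S) {-2}S (erefl (size S)) A B => [|n IH] S Sn A B leaf uS uA uB wS.
  by rewrite (size0nil Sn) big_nil addr_ge0// sumr_ge0.
have [||e eS eleaf] := leaf S; [by case: S Sn {leaf uS wS}|by []|].
have [lA rB wle wre] := wS e eS.
have sz : size (rem e S) = n by rewrite size_rem// Sn.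
have sub : {subset rem e S <= S} by exact: mem_rem.
have leaf' S' : S' != [::] -> {subset S' <= rem e S} -> exists2 e, e \in S' &
    (forall e', e' \in S' -> l e' = l e -> e' = e) \/
    (forall e', e' \in S' -> r e' = r e -> e' = e).
  by move=> S0 S'S; apply: leaf => // e' /S'S; exact: sub.
rewrite (big_rem e)//=; case: eleaf => el.
  rewrite (big_rem (l e) lA)//= -addrA; apply: lerD => //.
  apply: (IH _ sz _ _ leaf'); rewrite ?rem_uniq// => e' e'S.
  have [lA' rB' ? ?] := wS _ (sub _ e'S); split=> //.
  rewrite mem_rem_uniq// inE lA' andbT; apply/eqP => /(el _ (sub _ e'S)) ee.
  by move: e'S; rewrite ee mem_rem_uniq// inE eqxx.
rewrite [X in _ <= _ + X](big_rem (r e) rB)//= addrCA; apply: lerD => //.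
apply: (IH _ sz _ _ leaf'); rewrite ?rem_uniq// => e' e'S.
have [lA' rB' ? ?] := wS _ (sub _ e'S); split=> //.
rewrite mem_rem_uniq// inE rB' andbT; apply/eqP => /(el _ (sub _ e'S)) ee.
by move: e'S; rewrite ee mem_rem_uniq// inE eqxx.
Qed.

Lemma homeo_monotone (R : realType) (g : homeo R) :
  {homo g : s t / s < t} \/ {homo g : s t /~ s < t}.
Proof.
have ctg : {within [set` `]-oo, +oo[%R], continuous g}.
  by apply: continuous_subspaceT => t; exact: homeo_continuous.
have ing : {in `]-oo, +oo[ &, injective g}.
  by move=> s t _ _; exact: can_inj (@homeo_funK _ g) _ _.
by case: (itv_continuous_inj_mono ctg ing) => mg; [left|right] => s t st;
  have := mg s t; rewrite !in_itv => /(_ isT isT) ->.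
Qed.

Section Moebius.
Variables (R : realType) (z : R).
Hypotheses (z0 : 0 < z) (zs : z <= 1 / 200).

Definition parabolic_fun i t : R := (parabolic z i (t, 1)).1 / (parabolic z i (t, 1)).2.

Lemma den_itv i t : 1 <= t <= 2 -> 1 / 2 <= (parabolic z i (t, 1)).2 <= 1.
Proof.
move=> /andP[t1 t2]; have zt0 : 0 <= z * t by apply: mulr_ge0; move: z0; lra.
have zt1 : z * t <= z * 2 by rewrite ler_pM2l//; lra.
by case: i => [[]|] /=; apply/andP; split; move: z0 zs; lra.
Qed.

(** This is where 23/12 comes from: the three maps move points of [1, 2] to the
right by less than 1/12. *)
Lemma parabolic_fun_itv i t : 1 <= t <= 23 / 12 -> 1 <= parabolic_fun i t <= 2.
Proof.
move=> /andP[t1 t2]; have t12 : 1 <= t <= 2 by apply/andP; split; lra.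
have /andP[d0 d1] := den_itv i t12; have {}d0 : 0 < (parabolic z i (t, 1)).2 by lra.
rewrite /parabolic_fun ler_pdivlMr// ler_pdivrMr//.
have zt0 : 0 <= z * t by apply: mulr_ge0; move: z0; lra.
have zt1 : z * t <= z * 2 by rewrite ler_pM2l//; lra.
by case: i {d0 d1} => [[]|] /=; apply/andP; split; move: z0 zs; lra.
Qed.

(** The denominators lie in ]0, 1] because z > 0, and the matrices have
determinant 1. *)
Lemma parabolic_fun_expand i s t : 1 <= s -> s <= t -> t <= 2 -> t - s <= parabolic_fun i t - parabolic_fun i s.
Proof.
move=> s1 st t2.
have /andP[ds0 ds1] := den_itv i (t := s) ltac:(by apply/andP; split; lra).
have /andP[dt0 dt1] := den_itv i (t := t) ltac:(by apply/andP; split; lra).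
have dpos : 0 < (parabolic z i (t, 1)).2 * (parabolic z i (s, 1)).2 by apply: mulr_gt0; lra.
have -> : parabolic_fun i t - parabolic_fun i s = (t - s) / ((parabolic z i (t, 1)).2 * (parabolic z i (s, 1)).2).
  have ns : (parabolic z i (s, 1)).2 != 0 by apply/lt0r_neq0; lra.
  have nt : (parabolic z i (t, 1)).2 != 0 by apply/lt0r_neq0; lra.
  by rewrite /parabolic_fun; case: i ns nt {ds0 ds1 dt0 dt1 dpos} => [[]|] /= ns nt; field;
    rewrite ?ns ?nt.
rewrite ler_pdivlMr//; apply: ler_piMr; first by rewrite subr_ge0.
by apply: mulr_ile1 => //; lra.
Qed.

(** Turns an equation between values of the maps into one step of [run]. *)
Lemma parabolic_fun_eq i j s t : 1 <= s <= 2 -> 1 <= t <= 2 -> parabolic_fun i s = parabolic_fun j t ->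
  exists k, parabolic (- z) j (parabolic z i (s, 1)) = (k * t, k).
Proof.
move=> /(den_itv i)/andP[ds _] /(den_itv j)/andP[dt _] e.
exists ((parabolic z i (s, 1)).2 / (parabolic z j (t, 1)).2).
set c := (parabolic z i (s, 1)).2 in ds *; set c' := (parabolic z j (t, 1)).2 in dt *.
have nc : c != 0 by apply/lt0r_neq0; lra.
have nc' : c' != 0 by apply/lt0r_neq0; lra.
have Es : parabolic z i (s, 1) = (c * parabolic_fun i s, c).
  by rewrite /parabolic_fun -/c mulrC divfK//; case: parabolic @c {e ds nc}.
have Et : parabolic z j (t, 1) = (c' * parabolic_fun j t, c').
  by rewrite /parabolic_fun -/c' mulrC divfK//; case: parabolic @c' {e dt nc' Es}.
have -> : parabolic z i (s, 1) = (c / c' * (parabolic z j (t, 1)).1, c / c' * (parabolic z j (t, 1)).2).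
  by rewrite Es e Et /= mulrA divfK// divfK.
move: (c / c') => k; case: (j) => [[]|] /=; congr pair; ring.
Qed.

End Moebius.

(** * Expansion of finite sets of homeomorphisms *)

Section Expansion.
Variables (R : realType) (z : R) (x : cusp -> homeo R).
Hypotheses (z0 : 0 < z) (zs : z <= 1 / 200) (gz : generic z).
Hypothesis xE : forall i t, 1 <= t <= 2 -> x i t = parabolic_fun z i t.

Let mulE (g h : homeo R) t : (g * h)%g t = g (h t). Proof. by []. Qed.

(** An edge (g, i) joins g to x_i g. Without a leaf one can walk from edge to edge
for ever, leaving every vertex by another edge than the one used to reach it.
Since S is finite some edge recurs, which closes a reduced word; following the
images of the points of [u, v] along the walk, this word fixes them all. *)
Lemma acyclic_on_interval (u v : R) (S : seq (homeo R * cusp)) : u < v ->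
  S != [::] -> (forall e t, e \in S -> u <= t <= v -> 1 <= e.1 t <= 2) ->
  exists2 e, e \in S &
    (forall e', e' \in S -> e'.1 = e.1 -> e' = e) \/
    (forall e', e' \in S -> (x e'.2 * e'.1 = x e.2 * e.1)%g -> e' = e).
Proof.
move=> uv S0 inJ; apply: contrapT => noleaf.
have step e : exists p : cusp * (homeo R * cusp), e \in S ->
    [/\ p.2 \in S, p.1 != e.2, p.2.2 != p.1 & (x p.1 * p.2.1 = x e.2 * e.1)%g].
  have [eS|] := boolP (e \in S); last by exists (None, e).
  apply: contrapT => nstep; apply: (noleaf); exists e => //; right => f fS fe.
  apply: contrapT => nfe; have nj : f.2 != e.2.
    apply/eqP => ef; apply: (nfe); move: fe; rewrite ef => /mulgI.
    by move=> fe1; rewrite (surjective_pairing f) (surjective_pairing e) fe1 ef.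
  apply: (noleaf); exists f => //; left => f' f'S ff'.
  apply: contrapT => nff'; apply: (nstep); exists (f.2, f') => _; split=> //=.
    by apply/eqP => ef; apply: (nff'); rewrite (surjective_pairing f) (surjective_pairing f') ff' ef.
  by rewrite ff'.
have [nx nxP] := choice step.
pose e_ n := iter n (fun e => (nx e).2) (head (1%g, None) S).
have eS n : e_ n \in S.
  elim: n => [|n IH]; first by rewrite /e_ /=; case: (S) S0 => //= *; rewrite mem_head.
  by have [] := nxP _ IH.
have [m [d emd]] : exists m d, e_ (m + d.+1)%N = e_ m.
  pose s := [seq e_ n | n <- iota 0 (size S).+1].
  have : ~~ uniq s.
    apply/negP => us; have /(uniq_leq_size us) : {subset s <= S}.
      by move=> _ /mapP[n _ ->].
    by rewrite size_map size_iota ltnn.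
  move=> /(uniqPn (1%g, None))[m [n [mn]]]; rewrite size_map size_iota => nS.
  rewrite !(nth_map 0%N) ?size_iota// 1?(ltn_trans mn)// !nth_iota// ?(ltn_trans mn)// !add0n => e.
  by exists m, (n - m).-1; rewrite prednK ?subn_gt0// subnKC// ltnW.
pose wd m d := [seq ((e_ k).2, (nx (e_ k)).1) | k <- iota m d].
have redw k d' s : s != (e_ k).2 -> reduced s (wd k d').
  elim: d' k s => //= d' IH k s sk; rewrite eq_sym sk /=.
  by have [_ -> e2 _] := nxP _ (eS k); rewrite IH// eq_sym.
have runw d' k t : u <= t <= v -> exists c : R,
    run z (wd k d') ((e_ k).1 t, 1) = (c * (e_ (k + d')%N).1 t, c).
  move=> tuv.
  have runZ w' c (p : R * R) : run z w' (c * p.1, c * p.2) =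
      (c * (run z w' p).1, c * (run z w' p).2).
    have [a1 [b1 [c1 [d1 E]]]] := run_linear z w'.
    by rewrite !E /=; congr pair; ring.
  elim: d' k => [|d' IH] k /=; first by exists 1; rewrite addn0 mul1r.
  have [_ _ _ e2] := nxP _ (eS k).
  have J1 := inJ _ _ (eS k) tuv; have J2 := inJ _ _ (eS k.+1) tuv.
  have e3 : parabolic_fun z (e_ k).2 ((e_ k).1 t) = parabolic_fun z (nx (e_ k)).1 ((e_ k.+1).1 t).
    by rewrite -!xE// -!mulE e2.
  have [c cE] := parabolic_fun_eq z0 zs J1 J2 e3.
  have [c' c'E] := IH k.+1; exists (c * c').
  rewrite /wd /= /run /= -/(run _ _ _) cE.
  by have := runZ (wd k.+1 d') c ((e_ k.+1).1 t, 1); rewrite /= mulr1 => ->;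
    rewrite c'E !(addSn, addnS) /= mulrA.
pose s0 : cusp := if (e_ m).2 is None then Some true else None.
have s0P : s0 != (e_ m).2 by rewrite /s0; case: (e_ m).2.
pose mid := (u + v) / 2.
have um : u < mid by rewrite /mid; lra.
have mv : mid < v by rewrite /mid; lra.
have fixg t : t \in [:: u; mid; v] -> exists c, run z (wd m d.+1) ((e_ m).1 t, 1) = (c * (e_ m).1 t, c).
  rewrite !inE => tin; have := runw d.+1 m t; rewrite emd; apply.
  by apply/andP; case/or3P: tin => /eqP ->; split; lra.
have nzw : wd m d.+1 != [::] by [].
have [inc|dec] := homeo_monotone (e_ m).1.
  apply: (run_not_scalar gz nzw (redw m d.+1 s0 s0P) (inc _ _ um) (inc _ _ mv)) => t.
  by rewrite !inE => /or3P[]/eqP ->; apply: fixg; rewrite !inE eqxx ?orbT.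
apply: (run_not_scalar gz nzw (redw m d.+1 s0 s0P) (dec _ _ mv) (dec _ _ um)) => t.
by rewrite !inE => /or3P[]/eqP ->; apply: fixg; rewrite !inE eqxx ?orbT.
Qed.

(** Clamping to [c, d] lets lengths be summed over all pieces at once: a piece
mapped outside [c, d] contributes 0 and the sum telescopes. *)
Definition clamp (c d t : R) := if t <= c then c else if d <= t then d else t.

Definition len c d u v (g : homeo R) := `|clamp c d (g v) - clamp c d (g u)|.

Lemma len_ge0 c d u v g : 0 <= len c d u v g. Proof. exact: normr_ge0. Qed.

Lemma homeo_monotone_le (g : homeo R) :
  {mono g : s t / s <= t} \/ {mono g : s t /~ s <= t}.
Proof. by have [h|h] := homeo_monotone g; [left; exact: le_mono|right; exact: le_nmono]. Qed.

Lemma clamp_below c d t : t <= c -> clamp c d t = c.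
Proof. by rewrite /clamp => ->. Qed.

Lemma clamp_above c d t : c <= d -> d <= t -> clamp c d t = d.
Proof.
move=> cd dt; rewrite /clamp dt; case: ifPn => // tc.
by apply/le_anti; rewrite cd (le_trans dt).
Qed.

Lemma len_active (g : homeo R) u v c d t : u <= t <= v -> c <= d ->
  (homeo_inv g c <= u \/ v <= homeo_inv g c) ->
  (homeo_inv g d <= u \/ v <= homeo_inv g d) ->
  len c d u v g != 0 -> c <= g t <= d.
Proof.
move=> /andP[ut tv] cd hc hd; apply: contraNT; rewrite negb_and -!ltNge => out.
rewrite normr_eq0 subr_eq0; apply/eqP.
suff : (g u <= c /\ g v <= c) \/ (d <= g u /\ d <= g v).
  by case=> -[gu gv]; rewrite ?(clamp_below _ gu) ?(clamp_below _ gv)//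
    (clamp_above cd gu) (clamp_above cd gv).
have [mg|mg] := homeo_monotone_le g.
- have gut : g u <= g t by rewrite mg.
  have gtv : g t <= g v by rewrite mg.
  move: hc hd; rewrite -!(mg (homeo_inv g _)) -!(mg _ (homeo_inv g _)) !homeo_invK.
  move=> hc hd; case/orP: out => out; [left; case: hc|right; case: hd] => h; split; lra.
- have gut : g t <= g u by rewrite mg.
  have gtv : g v <= g t by rewrite mg.
  move: hc hd; rewrite -!(mg (homeo_inv g _)) -!(mg _ (homeo_inv g _)) !homeo_invK.
  move=> hc hd; case/orP: out => out; [left; case: hc|right; case: hd] => h; split; lra.
Qed.

Lemma clamp_id c d t : c <= t <= d -> clamp c d t = t.
Proof. by move=> /andP[h1 h2]; rewrite /clamp; do 2?[case: ifPn; rewrite -?ltNge => ?]; lra. Qed.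

(** The hypothesis on u and v says that no element of A sends a point of ]u, v[ to
an end of [1, 23/12], so a piece is mapped either into that interval or outside. *)
Lemma piece_bound (A B : seq (homeo R)) u v : u < v -> uniq A -> uniq B ->
  (forall g i, g \in A -> (x i * g)%g \in B) ->
  (forall g c, g \in A -> c \in [:: 1; 23 / 12] ->
     homeo_inv g c <= u \/ v <= homeo_inv g c) ->
  \sum_(g <- A) len 1 (23 / 12) u v g *+ 3 <=
  \sum_(g <- A) len 1 2 u v g + \sum_(g <- B) len 1 2 u v g.
Proof.
move=> uv uA uB AB cut.
have act g t : g \in A -> len 1 (23 / 12) u v g != 0 -> u <= t <= v -> 1 <= g t <= 23 / 12.
  move=> gA w0 tuv; apply: (len_active tuv) w0; first lra.
    by apply: cut => //; rewrite !inE eqxx.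
  by apply: cut => //; rewrite !inE eqxx orbT.
pose P := [seq (g, i) | g <- A, i <- enum {: cusp}].
have -> : \sum_(g <- A) len 1 (23 / 12) u v g *+ 3 =
    \sum_(e <- [seq e <- P | len 1 (23 / 12) u v e.1 != 0]) len 1 (23 / 12) u v e.1.
  rewrite big_filter [RHS]big_rmcond => [|e /negPn/eqP//]; rewrite big_allpairs.
  by apply: eq_bigr => g _; rewrite /= big_const_seq count_predT -cardE card_option card_bool iter_addr addr0.
have SP e : e \in [seq e <- P | len 1 (23 / 12) u v e.1 != 0] ->
    e.1 \in A /\ len 1 (23 / 12) u v e.1 != 0.
  by rewrite mem_filter => /andP[w0 /allpairsP[p [pA _ eE]]]; split=> //; rewrite eE.
apply: (forest_weight (l := fst) (r := fun e => (x e.2 * e.1)%g)) => //.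
- move=> S' S'0 S'S; apply: (acyclic_on_interval uv S'0) => e t /S'S/SP[eA w0] tuv.
  by have /andP[h1 h2] := act _ _ eA w0 tuv; apply/andP; split; lra.
- by rewrite filter_uniq// allpairs_uniq ?enum_uniq// => -[? ?] [? ?] _ _ /= [-> ->].
- move=> e /SP[eA w0].
  have Ju := act _ u eA w0 ltac:(by rewrite lexx ltW).
  have Jv := act _ v eA w0 ltac:(by rewrite lexx ltW).
  have wider (t : R) : 1 <= t <= 23 / 12 -> 1 <= t <= 2 by move=> /andP[*]; apply/andP; split; lra.
  split; rewrite ?AB//.
    by rewrite /len !clamp_id// wider.
  rewrite /len !mulE !xE ?wider// !clamp_id ?parabolic_fun_itv//.
  have [le|lt] := leP (e.1 u) (e.1 v).
    have ex := parabolic_fun_expand z0 zs e.2 (andP Ju).1 le ltac:(case/andP: Jv; lra).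
    by rewrite !ger0_norm; lra.
  have ex := parabolic_fun_expand z0 zs e.2 (andP Jv).1 (ltW lt) ltac:(case/andP: Ju; lra).
  by rewrite !ler0_norm; lra.
- by move=> g; exact: len_ge0.
- by move=> g; exact: len_ge0.
Qed.

Lemma clamp_itv c d t : c <= d -> c <= clamp c d t <= d.
Proof. by move=> cd; rewrite /clamp; do 2?[case: ifPn; rewrite -?ltNge => ?]; lra. Qed.

Lemma clamp_homo c d : c <= d -> {homo clamp c d : s t / s <= t}.
Proof.
by move=> cd s t st; rewrite /clamp; do 4?[case: ifPn; rewrite -?ltNge => ?]; lra.
Qed.

Lemma len_add c d u v w g : c <= d -> u <= v -> v <= w ->
  len c d u v g + len c d v w g = len c d u w g.
Proof.
move=> cd uv vw; rewrite /len; have cm := clamp_homo cd.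
have [mg|mg] := homeo_monotone_le g.
  have h1 : clamp c d (g u) <= clamp c d (g v) by apply: cm; rewrite mg.
  have h2 : clamp c d (g v) <= clamp c d (g w) by apply: cm; rewrite mg.
  by rewrite !ger0_norm; lra.
have h1 : clamp c d (g v) <= clamp c d (g u) by apply: cm; rewrite mg.
have h2 : clamp c d (g w) <= clamp c d (g v) by apply: cm; rewrite mg.
by rewrite !ler0_norm; lra.
Qed.

Lemma sum_len c d g (p : nat -> R) n : c <= d ->
  (forall k, (k < n)%N -> p k <= p k.+1) ->
  \sum_(0 <= k < n) len c d (p k) (p k.+1) g = len c d (p 0%N) (p n) g.
Proof.
move=> cd; elim: n => [|n IH] pk; first by rewrite big_geq// /len subrr normr0.
rewrite big_nat_recr//= IH => [|k kn]; last by apply: pk; exact: ltnW.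
apply: len_add => //; last exact: pk.
elim: n pk {IH} => // n IH pk; apply: le_trans (pk _ _); last exact: ltnW.
by apply: IH => k kn; apply: pk; exact: ltnW.
Qed.

Lemma len_le c d u v g : c <= d -> len c d u v g <= d - c.
Proof.
move=> cd; rewrite /len ler_norml.
have /andP[? ?] := clamp_itv (g u) cd; have /andP[? ?] := clamp_itv (g v) cd.
by apply/andP; split; lra.
Qed.

Lemma len_full c d u v g : c <= d ->
  u <= homeo_inv g c <= v -> u <= homeo_inv g d <= v -> len c d u v g = d - c.
Proof.
move=> cd /andP[uc cv] /andP[ud dv]; move: uc cv ud dv; rewrite /len /clamp.
have [mg|mg] := homeo_monotone_le g.
  rewrite -!(mg (homeo_inv g _)) -!(mg _ (homeo_inv g _)) !homeo_invK => *.
  rewrite (_ : g u <= c)// (_ : d <= g v)//; case: ifPn => gv.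
    by rewrite subrr normr0; lra.
  by rewrite ger0_norm; lra.
rewrite -!(mg (homeo_inv g _)) -!(mg _ (homeo_inv g _)) !homeo_invK => *.
rewrite (_ : g v <= c)// (_ : d <= g u)//; case: ifPn => gv.
  by rewrite subrr normr0; lra.
by rewrite ler0_norm; lra.
Qed.

(** Each element of A has three edges, each of total weight 11/12 over all pieces;
each vertex has total weight at most 1, so 3 * 11/12 * |A| <= |A| + |B|. *)
Lemma translates_expand (A B : seq (homeo R)) : uniq A -> uniq B ->
  (forall g i, g \in A -> (x i * g)%g \in B) -> (7 * size A <= 4 * size B)%N.
Proof.
move=> uA uB AB; have [->//|A0] := eqVneq A [::].
pose s := sort <=%O (undup [seq homeo_inv g c | g <- A, c <- [:: 1; 23 / 12 : R]]).
have sin g c : g \in A -> c \in [:: 1; 23 / 12] -> homeo_inv g c \in s.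
  by move=> gA cin; rewrite mem_sort mem_undup; apply/allpairsP; exists (g, c).
have slt : sorted <%O s by rewrite sort_lt_sorted undup_uniq.
have sle : sorted <=%O s by rewrite sort_le_sorted.
pose n := (size s).-1.
have sz : size s = n.+1.
  rewrite prednK//; case: A A0 {uA AB} @s @n sin {slt sle} => // g A' _ s n sin.
  by have := sin g 1; rewrite !inE !eqxx => /(_ isT isT); case: s {n sin}.
have le_nth i j : (i <= j)%N -> (j < size s)%N -> s`_i <= s`_j.
  by move=> ij js; apply: (sorted_leq_nth le_trans lexx) => //; rewrite inE// (leq_ltn_trans ij).
have cutP k t : t \in s -> (k < n)%N -> t <= s`_k \/ s`_k.+1 <= t.
  move=> ts kn; rewrite -(nth_index 0 ts).
  have := ts; rewrite -index_mem => its.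
  have [le|lt] := leqP (index t s) k; [left|right]; apply: le_nth => //.
  by rewrite sz ltnS ltnW.
have rng t : t \in s -> s`_0 <= t <= s`_n.
  move=> ts; rewrite -(nth_index 0 ts); have := ts; rewrite -index_mem => its.
  by rewrite !le_nth//; [rewrite -ltnS -sz|rewrite sz].
have pieces : \sum_(0 <= k < n) \sum_(g <- A) len 1 (23 / 12) s`_k s`_k.+1 g *+ 3 <=
    \sum_(0 <= k < n) (\sum_(g <- A) len 1 2 s`_k s`_k.+1 g +
                        \sum_(g <- B) len 1 2 s`_k s`_k.+1 g).
  apply: ler_sum_nat => k /andP[_ kn]; apply: piece_bound => // [|g c gA cin].
    by apply: (sorted_ltn_nth lt_trans) => //; rewrite inE sz ltnS// ltnW.
  exact/cutP/kn/sin.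
have step k : (k < n)%N -> s`_k <= s`_k.+1 by move=> kn; rewrite le_nth// sz.
have cst (C : seq (homeo R)) (a : R) : a *+ size C = \sum_(g <- C) a.
  by rewrite big_const_seq count_predT iter_addr_0.
have lhs : \sum_(0 <= k < n) \sum_(g <- A) len 1 (23 / 12) s`_k s`_k.+1 g *+ 3 =
    (11 / 12 *+ 3) *+ size A.
  rewrite exchange_big /= cst.
  rewrite big_seq [RHS]big_seq; apply: eq_bigr => g gA.
  rewrite sumrMnl (sum_len _ _ step)//; last lra.
  rewrite len_full; [congr (_ *+ _); lra|lra| |]; apply/rng/sin => //; rewrite !inE eqxx ?orbT//.
have rhs (C : seq (homeo R)) : \sum_(0 <= k < n) \sum_(g <- C) len 1 2 s`_k s`_k.+1 g <= (size C)%:R.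
  rewrite exchange_big /= cst.
  apply: ler_sum => g _; rewrite (sum_len _ _ step)//; last lra.
  apply: le_trans (len_le _ _ _ _) _; lra.
move: pieces; rewrite lhs big_split /= -mulrnA -[11 / 12 *+ _]mulr_natr => pieces.
have := le_trans pieces (lerD (rhs A) (rhs B)).
rewrite -(ler_nat R) !natrM => h; lra.
Qed.

End Expansion.

(** * A homeomorphism that inverts a prescribed compact interval *)

Lemma homeo_of_increasing (R : realType) (f g : R -> R) :
  cancel f g -> cancel g f -> {mono f : s t / s <= t} ->
  exists h : homeo R, homeo_fun h = f.
Proof.
have cont (f' g' : R -> R) : cancel g' f' -> {mono f' : s t / s <= t} -> continuous f'.
  move=> gK mf s; apply/cvgrPdist_le => e e0.
  have lo : g' (f' s - e) < s by rewrite -(leW_mono mf) gK; lra.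
  have hi : s < g' (f' s + e) by rewrite -(leW_mono mf) gK; lra.
  near=> t; have : t \in `]g' (f' s - e), g' (f' s + e)[.
    by near: t; apply: near_in_itvoo; rewrite in_itv/= lo hi.
  rewrite in_itv/= => /andP[]; rewrite -(leW_mono mf) gK => t1.
  rewrite -(leW_mono mf) gK => t2.
  by rewrite ler_norml; apply/andP; split; [clear -t2|clear -t1]; lra.
move=> fK gK mf.
have mg : {mono g : s t / s <= t} by move=> s t; rewrite -mf !gK.
by exists (Homeo fK gK (cont _ _ gK mf) (cont _ _ fK mg)).
Unshelve. all: by end_near. Qed.

Lemma increasing_glue (R : realType) (f : R -> R) (D : R -> bool) c :
  D c -> (forall s t, D s -> s < t -> t <= c -> f s < f t) ->
  (forall s t, D t -> s < t -> c <= s -> f s < f t) ->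
  forall s t, D s -> D t -> s < t -> f s < f t.
Proof.
move=> Dc lo hi s t Ds Dt st; have [tc|ct] := leP t c; first exact: lo.
have [cs|sc] := leP c s; first exact: hi.
by apply: lt_trans (hi c t Dt ct _) => //; apply: lo.
Qed.

Section Inversion.
Variables (R : realType) (N : R).
Hypothesis N2 : 2 <= N.

Let N0 : 0 < N. Proof. by apply: lt_le_trans N2; rewrite ltr0n. Qed.
Let nN : N != 0. Proof. exact: lt0r_neq0. Qed.

(** The element of F that sends the Farey points -oo, -N-1, -N, -1/N, 0, oo to
-oo, 0, 1/N, N, N+1, oo. *)
Definition inversion_fun (t : R) : R :=
  if t <= - (N + 1) then t + N + 1
  else if t <= - N then (t + N + 1) / ((N - 1) * t + N * N)
  else if t <= - N^-1 then - t^-1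
  else if t <= 0 then (N * N * t + N + 1) / ((N - 1) * t + 1)
  else t + N + 1.
Notation S := inversion_fun.

Let NV : N * N^-1 = 1. Proof. exact: divff. Qed.
Let NV0 : 0 < N^-1. Proof. by rewrite invr_gt0. Qed.
Let NV1 : N^-1 <= 1 / 2.
Proof. by rewrite div1r lef_pV2 ?posrE. Qed.

Let den1 t : - (N + 1) <= t -> 0 < (N - 1) * t + N * N.
Proof.
move=> ht; have -> : (N - 1) * t + N * N = (N - 1) * (t + (N + 1)) + 1 by ring.
by rewrite ltr_wpDl// mulr_ge0//; move: N2; lra.
Qed.
Let den3 t : - N^-1 <= t -> 0 < (N - 1) * t + 1.
Proof.
move=> ht.
have -> : (N - 1) * t + 1 = (N - 1) * (t + N^-1) + N^-1 by rewrite mulrDr !mulrBl NV; ring.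
by rewrite ltr_wpDl// mulr_ge0//; move: N2; lra.
Qed.

Lemma inversion_fun0 t : t <= - (N + 1) -> S t = t + N + 1.
Proof. by rewrite /S => ->. Qed.
Lemma inversion_fun1 t : - (N + 1) <= t -> t <= - N ->
  S t = (t + N + 1) / ((N - 1) * t + N * N).
Proof.
move=> t1 t2; rewrite /S t2; case: ifPn => // t3.
have -> : t = - (N + 1) by apply/le_anti; rewrite t1 t3.
have -> : - (N + 1) + N + 1 = 0 by ring.
by rewrite mul0r.
Qed.
Lemma inversion_fun2 t : - N <= t -> t <= - N^-1 -> S t = - t^-1.
Proof.
move=> t1 t2; rewrite /S t2.
case: ifPn => [t3|_]; first by move: t1 t3; lra.
case: ifPn => // t3; have -> : t = - N by apply/le_anti; rewrite t1 t3.
have -> : (N - 1) * - N + N * N = N by ring.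
by rewrite addNr add0r div1r invrN opprK.
Qed.
Lemma inversion_fun3 t : - N^-1 <= t -> t <= 0 ->
  S t = (N * N * t + N + 1) / ((N - 1) * t + 1).
Proof.
move=> t1 t2; rewrite /S t2.
have [t3 t4] : (t <= - (N + 1)) = false /\ (t <= - N) = false.
  by split; apply/negbTE; rewrite -ltNge; move: N2 NV1; lra.
rewrite t3 t4; case: ifPn => // t5; have -> : t = - N^-1 by apply/le_anti; rewrite t1 t5.
have -> : (N - 1) * - N^-1 + 1 = N^-1 by rewrite mulrBl !mulrN NV; ring.
by rewrite invrN opprK invrK mulrN mulfK// addNr add0r mul1r.
Qed.
Lemma inversion_fun4 t : 0 <= t -> S t = t + N + 1.
Proof.
move=> t0; rewrite /S.
have [t3 t4 t5] : [/\ (t <= - (N + 1)) = false, (t <= - N) = false & (t <= - N^-1) = false].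
  by split; apply/negbTE; rewrite -ltNge; move: N2 NV1 NV0; lra.
rewrite t3 t4 t5; case: ifPn => // t6; have -> : t = 0 by apply/le_anti; rewrite t0 t6.
by rewrite !mulr0 !add0r divr1.
Qed.

(** Up to sign the map is an involution, so it also provides its own inverse. *)
Lemma inversion_funK t : S (- S t) = - t.
Proof.
have [h0|h0] := leP t (- (N + 1)).
  by rewrite (inversion_fun0 h0) inversion_fun4; lra.
have [h1|h1] := leP t (- N).
  have d := den1 (ltW h0); rewrite (inversion_fun1 (ltW h0) h1) inversion_fun3.
  - have nd := lt0r_neq0 d; set D := (N - 1) * t + N * N in d nd *.
    have -> : (N - 1) * - ((t + N + 1) / D) + 1 = D^-1.
      by apply: (mulIf nd); rewrite mulVf// mulrDl mulrN mulNr mulrA divfK// /D; ring.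
    rewrite invrK mulrDl mulrDl mulrN mulNr mulrA divfK// /D; ring.
  - rewrite lerN2 ler_pdivrMr// -(ler_pM2l N0) mulrA NV mul1r.
    rewrite -subr_ge0.
    have -> : (N - 1) * t + N * N - N * (t + N + 1) = - t - N by ring.
    by lra.
  - by rewrite oppr_le0; apply: divr_ge0; lra.
have [h2|h2] := leP t (- N^-1).
  rewrite (inversion_fun2 (ltW h1) h2) opprK inversion_fun2 ?invrK//.
    have -> : - N = (- N^-1)^-1 by rewrite invrN invrK.
    by rewrite lef_nV2 ?negrE//; move: N0 NV0; lra.
  by rewrite -invrN lef_nV2 ?negrE//; move: N0 NV0; lra.
have [h3|h3] := leP t 0.
  have d := den3 (ltW h2); rewrite (inversion_fun3 (ltW h2) h3) inversion_fun1.
  - have nd := lt0r_neq0 d; set D := (N - 1) * t + 1 in d nd *.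
    have -> : (N - 1) * - ((N * N * t + N + 1) / D) + N * N = D^-1.
      by apply: (mulIf nd); rewrite mulVf// mulrDl mulrN mulNr mulrA divfK// /D; ring.
    rewrite invrK mulrDl mulrDl mulNr divfK// /D; ring.
  - rewrite lerN2 ler_pdivrMr// -subr_ge0.
    have -> : (N + 1) * ((N - 1) * t + 1) - (N * N * t + N + 1) = - t by ring.
    by rewrite oppr_ge0.
  - rewrite lerN2 ler_pdivlMr// -subr_ge0.
    have -> : N * N * t + N + 1 - N * ((N - 1) * t + 1) = N * t + 1 by ring.
    by have := ltW h2; rewrite -(ler_pM2l N0) mulrN NV; lra.
by rewrite (inversion_fun4 (ltW h3)) inversion_fun0; lra.
Qed.

Let frac_lt (p q k l s t : R) : p * l - q * k = 1 ->
  0 < k * s + l -> 0 < k * t + l -> s < t ->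
  (p * s + q) / (k * s + l) < (p * t + q) / (k * t + l).
Proof.
move=> det s0 t0 st; rewrite ltr_pdivrMr// mulrAC ltr_pdivlMr// -subr_gt0.
have -> : (p * t + q) * (k * s + l) - (p * s + q) * (k * t + l) =
  (p * l - q * k) * (t - s) by ring.
by rewrite det mul1r subr_gt0.
Qed.

Lemma inversion_fun_lt : {homo S : s t / s < t}.
Proof.
suff inc : forall s t, true -> true -> s < t -> S s < S t by move=> s t; exact: inc.
apply: (@increasing_glue _ _ xpredT (- (N + 1))) => // s t _ st.
  by move=> tc; rewrite !inversion_fun0; lra.
move=> hs; have ht : - (N + 1) <= t by lra.
move: s t hs ht st; apply: (@increasing_glue _ S (fun t => - (N + 1) <= t) (- N)).
- lra.
- move=> s t hs st ht; rewrite !inversion_fun1 -?addrA; try lra.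
  rewrite -[s in X in X / _]mul1r -[t in X in _ < X / _]mul1r.
  by apply: frac_lt => //; [ring|apply: den1; lra|apply: den1; lra].
move=> s t _ st hs; have ht : - N <= t by lra.
move: s t hs ht st; apply: (@increasing_glue _ S (fun t => - N <= t) (- N^-1)).
- by move: NV1 N2; lra.
- move=> s t hs st ht; rewrite !inversion_fun2; try lra.
  by rewrite ltrN2 ltf_nV2 ?negrE//; move: NV0; lra.
move=> s t _ st hs; have ht : - N^-1 <= t by lra.
move: s t hs ht st; apply: (@increasing_glue _ S (fun t => - N^-1 <= t) 0).
- by move: NV0; lra.
- move=> s t hs st ht; rewrite !inversion_fun3 -?addrA; try lra.
  by apply: frac_lt => //; [ring|apply: den3; lra|apply: den3; lra].
by move=> s t _ st hs; rewrite !inversion_fun4; lra.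
Qed.

Lemma inversion_homeo : exists h : homeo R, homeo_fun h = S.
Proof.
apply: (@homeo_of_increasing _ S (fun t => - S (- t))) => [t|t|].
- by rewrite /= inversion_funK opprK.
- by rewrite /= inversion_funK opprK.
- exact: le_mono inversion_fun_lt.
Qed.

End Inversion.

(** * Moebius maps realized by the group on compact intervals *)

Lemma inversion_in_F (R : realType) (n : int) (h : homeo R) : 2 <= n ->
  homeo_fun h = inversion_fun (n%:~R : R) -> F_PSL2Z R h.
Proof.
move=> n2 hE; pose N : R := n%:~R.
have N2 : 2 <= N by rewrite (ler_int R 2).
have N0 : 0 < N by lra.
have NV0 : 0 < N^-1 by rewrite invr_gt0.
have NV1 : N^-1 <= 1 / 2 by rewrite div1r lef_pV2 ?posrE.
have NV : N * N^-1 = 1 by rewrite divff// lt0r_neq0.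
pose b : seq rat := [:: - (n + 1)%:~R; - n%:~R; - (n%:~R)^-1; 0].
have b0E : ratr (- (n + 1)%:~R) = - (N + 1) :> R by rewrite rmorphN /= ratr_int intrD.
have b1E : ratr (- n%:~R) = - N :> R by rewrite rmorphN /= ratr_int.
have b2E : ratr (- (n%:~R)^-1) = - N^-1 :> R by rewrite rmorphN fmorphV /= ratr_int.
exists b; split.
  rewrite /b /= !andbT -!(ltr_rat R) b0E b1E b2E rmorph0.
  by apply/and3P; split; lra.
rewrite hE; case=> [|[|[|[|[|//]]]]] _.
- exists 1, (n + 1), 0, 1; split=> [|t]; first by ring.
  rewrite /= in_itv /= b0E => ht.
  by rewrite inversion_fun0// mul0r add0r oner_eq0 mul1r divr1 intrD addrA.
- exists 1, (n + 1), (n - 1), (n * n); split=> [|t]; first by ring.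
  rewrite /= in_itv /= b0E b1E => /andP[t0 t1].
  rewrite inversion_fun1// !intrD intrM mulrN1z mul1r addrA; split=> //.
  apply: lt0r_neq0.
  have -> : (N - 1) * t + N * N = (N - 1) * (t + (N + 1)) + 1 by ring.
  by rewrite ltr_wpDl// mulr_ge0//; lra.
- exists 0, (-1), 1, 0; split=> // t; rewrite /= in_itv /= b1E b2E => /andP[t0 t1].
  rewrite inversion_fun2// mul0r add0r mul1r addr0 mulrN1z mulNr div1r; split=> //.
  by apply: ltr0_neq0; lra.
- exists (n * n), (n + 1), (n - 1), 1; split=> [|t]; first by ring.
  rewrite /= in_itv /= b2E rmorph0 => /andP[t0 t1].
  rewrite inversion_fun3// !intrD intrM mulrN1z addrA; split=> //.
  apply: lt0r_neq0.
  have -> : (N - 1) * t + 1 = (N - 1) * (t + N^-1) + N^-1 by rewrite mulrDr !mulrBl NV; ring.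
  by rewrite ltr_wpDl// mulr_ge0//; lra.
- exists 1, (n + 1), 0, 1; split=> [|t]; first by ring.
  rewrite /= in_itv /= rmorph0 => /andP[ht _].
  by rewrite inversion_fun4// mul0r add0r oner_eq0 mul1r divr1 intrD addrA.
Qed.

Lemma translation_in_F (R : realType) (h : homeo R) :
  (forall t, h t = 1 * t + 1) -> F_PSL2Z R h.
Proof.
move=> hE; exists [::]; split=> // -[|//] _; exists 1, 1, 0, 1; split=> // t _.
by rewrite hE mul0r add0r oner_eq0 divr1.
Qed.

Section GeneratedSubgroup.
Variables (G : groupType) (A : set G).
Local Notation L := (generated_subgroup A).
Local Open Scope group_scope.

Lemma gen_sub : A `<=` L. Proof. by move=> g Ag H [_]; apply. Qed.

Lemma gen1 : L 1.
Proof. by move=> H [[H1 _] _]; exact: set_mem. Qed.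

Lemma gen_div g h : L g -> L h -> L (g / h).
Proof.
move=> Lg Lh H [HG AH]; have [_ HD] := HG.
by apply: set_mem; apply: HD; apply: mem_set; [exact: Lg|exact: Lh].
Qed.

Lemma genV g : L g -> L g^-1.
Proof. by move=> Lg; rewrite -[g^-1]mul1g; apply: gen_div Lg; exact: gen1. Qed.

Lemma genM g h : L g -> L h -> L (g * h).
Proof. by move=> Lg Lh; rewrite -[h]invgK; apply: gen_div => //; exact: genV. Qed.

End GeneratedSubgroup.

Section Realization.
Variables (R : realType) (f : homeo R).
Local Notation L := (generated_subgroup (F_PSL2Z R `|` [set f])).
Implicit Types (u v : R) (phi psi : R -> R).

(** All elements of the group fix the point oo, hence agree with a Moebius map such
as an inversion only away from its pole. *)
Definition realized phi u v :=
  exists2 g, L g & forall t, u <= t <= v -> g t = phi t.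

(** Checking the endpoints suffices, since a homeomorphism of the line is
monotone. *)
Lemma realized_comp phi psi u v : u < v -> phi u < phi v ->
  realized phi u v -> realized psi (phi u) (phi v) -> realized (psi \o phi) u v.
Proof.
move=> uv puv [g Lg gE] [h Lh hE]; exists (h * g)%g; first exact: genM.
move=> t /andP[ut tv]; rewrite -[LHS]/(h (g t)) hE ?gE ?ut//.
have gu : g u = phi u by rewrite gE// lexx ltW.
have gv : g v = phi v by rewrite gE// lexx ltW.
rewrite -(gE t) ?ut// -gu -gv.
have [mg|mg] := homeo_monotone_le g; first by rewrite !mg ut tv.
by have := ltW uv; rewrite -mg gu gv leNgt puv.
Qed.

Lemma realized_ext phi psi u v : (forall t, u <= t <= v -> phi t = psi t) ->
  realized phi u v -> realized psi u v.
Proof. by move=> e [g Lg gE]; exists g => // t tuv; rewrite gE// e. Qed.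

Lemma realized_inv phi psi u v : u < v -> realized psi (phi u) (phi v) ->
  (forall t, u <= t <= v -> phi u <= phi t <= phi v /\ psi (phi t) = t) ->
  realized phi u v.
Proof.
move=> uv [g Lg gE] pK; exists g^-1%g => [|t tuv]; first exact: genV.
have [tr e] := pK t tuv; rewrite -[in LHS]e -gE//; exact: homeo_funK.
Qed.

Lemma realized_inversion_neg u v : v < 0 -> realized (fun t => - t^-1) u v.
Proof.
move=> v0; pose n : int := Num.max 2 (Num.max (Num.floor (- u) + 1) (Num.floor (- v^-1) + 1)).
have n2 : 2 <= n by rewrite /n le_max lexx.
have [h hE] := @inversion_homeo R n%:~R ltac:(by rewrite (ler_int R 2)).
exists h; first by apply: gen_sub; left; exact: inversion_in_F hE.
have fl (y : R) : y < (Num.floor y + 1)%:~R by exact: floorD1_gt.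
have nu : - u <= n%:~R.
  by apply: le_trans (ltW (fl _)) _; rewrite ler_int /n !le_max lexx orbT.
have nv : - v^-1 <= n%:~R.
  by apply: le_trans (ltW (fl _)) _; rewrite ler_int /n !le_max lexx !orbT.
have N2 : 2 <= n%:~R :> R by rewrite (ler_int R 2).
move=> t /andP[ut tv]; rewrite hE; apply: inversion_fun2 => //.
- by move: ut nu; lra.
- apply: le_trans tv _; rewrite lerNr -[leRHS]invrK lef_pV2 ?posrE ?invr_gt0 ?oppr_gt0 ?invrN//.
  by move: N2; lra.
Qed.

Lemma realized_sub phi u v u' v' : u <= u' -> v' <= v -> realized phi u v -> realized phi u' v'.
Proof.
move=> uu vv [g Lg gE]; exists g => // t /andP[ut tv]; apply: gE.
by rewrite (le_trans uu)//= (le_trans tv).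
Qed.

Lemma realized_inversion_pos u v : 0 < u -> realized (fun t => - t^-1) u v.
Proof.
move=> u0; pose w := Num.max v (u + 1).
have uw : u < w by rewrite lt_max; apply/orP; right; lra.
apply: (@realized_sub _ u w) => //; first by rewrite le_max lexx.
apply: (@realized_inv _ (fun t => - t^-1)) => //.
  by apply: realized_inversion_neg; rewrite oppr_lt0 invr_gt0; lra.
move=> t /andP[ut tw]; rewrite invrN invrK opprK; split=> //.
by rewrite !lerN2 !lef_pV2 ?posrE ?ut//; lra.
Qed.

Definition local_translation z := forall u v, realized (fun t => t + z) u v.

Lemma local_translation1 : local_translation 1.
Proof.
move=> u v; have [g gE] := @affine_homeo_exists R 1 1 ltr01.
exists g => [|t _]; last by rewrite gE mul1r.
by apply: gen_sub; left; apply: translation_in_F.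
Qed.

Lemma local_translationD y z : local_translation y -> local_translation z ->
  local_translation (y + z).
Proof.
move=> hy hz u v; pose w := Num.max v (u + 1).
have uw : u < w by rewrite lt_max; apply/orP; right; lra.
apply: (@realized_sub _ u w) => //; first by rewrite le_max lexx.
apply: (@realized_ext ((fun t => t + z) \o (fun t => t + y))) => [t _ /=|].
  by rewrite addrA.
by apply: realized_comp => //; lra.
Qed.

Lemma local_translationN z : local_translation z -> local_translation (- z).
Proof.
move=> hz u v; pose w := Num.max v (u + 1).
have uw : u < w by rewrite lt_max; apply/orP; right; lra.
apply: (@realized_sub _ u w) => //; first by rewrite le_max lexx.
apply: (@realized_inv _ (fun t => t + z)) => // t /andP[ut tw].
by rewrite !lerD2r ut tw; split=> //; lra.
Qed.

Lemma local_translationMz z (n : int) : local_translation z -> local_translation (n%:~R * z).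
Proof.
have h0 : local_translation 0.
  by move=> u v; exists 1%g => [|t _]; [exact: gen1|rewrite addr0].
move=> hz; elim/int_rec: n => [|n IH|n IH]; first by rewrite mul0r.
  by rewrite -[n.+1]addn1 PoszD intrD mulrDl mul1r; apply: local_translationD.
rewrite -[n.+1]addn1 PoszD opprD intrD mulrDl mulrN1z mulN1r.
exact/local_translationD/local_translationN.
Qed.

Lemma local_translation_int (n : int) : local_translation n%:~R.
Proof. by rewrite -[_%:~R]mulr1; apply: local_translationMz; exact: local_translation1. Qed.

(** The maps fixing 0 and -1 are conjugate to the translation by z under t |-> -1/t
and under t |-> -1/(t + 1). *)
Lemma realized_parabolics z : 0 < z -> z <= 1 / 200 -> local_translation z ->
  exists x : cusp -> homeo R, (forall i, L (x i)) /\
    forall i t, 1 <= t <= 2 -> x i t = parabolic_fun z i t.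
Proof.
move=> z0 zs hz; suff h i : realized (parabolic_fun z i) 1 2.
  exists (fun i => projT1 (cid2 (h i))); split=> i; first by case: cid2.
  by case: cid2 => g Lg /= gE t; exact: gE.
have h2 : realized (fun t => t / (1 - z * t)) 1 3.
  apply: (@realized_ext ((fun t => - t^-1) \o ((fun t => t + z) \o (fun t => - t^-1)))).
    move=> t /andP[t1 t3] /=; have zt : z * t <= z * 3 by rewrite ler_pM2l.
    have nt : t != 0 by apply: lt0r_neq0; lra.
    have nd : 1 - z * t != 0 by apply: lt0r_neq0; lra.
    have -> : - t^-1 + z = - ((1 - z * t) / t) by field.
    by rewrite invrN opprK invf_div.
  apply: realized_comp; [lra| | |].
  - by rewrite /= invr1; lra.
  - by apply: realized_comp; [lra|rewrite invr1; lra|apply: realized_inversion_pos; lra|exact: hz].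
  - by apply: realized_inversion_neg; rewrite /=; lra.
case: i => [[]|].
- apply: (realized_ext _ (realized_sub (lexx _) _ h2)); last lra.
  by move=> t _; rewrite /parabolic_fun /= mulrC.
- apply: (@realized_ext ((fun t => t + -1) \o ((fun t => t / (1 - z * t)) \o (fun t => t + 1)))).
    move=> t /andP[t1 t2]; rewrite /parabolic_fun /=; have zt : z * t <= z * 2 by rewrite ler_pM2l.
    by field; apply: lt0r_neq0; lra.
  have d2 : 0 < 1 - z * (1 + 1) by lra.
  have d3 : 0 < 1 - z * (2 + 1) by lra.
  have lt23 : (1 + 1) / (1 - z * (1 + 1)) < (2 + 1) / (1 - z * (2 + 1)).
    rewrite ltr_pdivrMr// mulrAC ltr_pdivlMr//; lra.
  apply: realized_comp; [lra|exact: lt23| |exact/local_translationN/local_translation1].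
  apply: realized_comp; [lra|lra|exact: local_translation1|].
  by apply: realized_sub h2; lra.
- by apply: (realized_ext _ (hz 1 2)) => t _; rewrite /parabolic_fun /= mulr1 divr1.
Qed.

End Realization.

(** * Arbitrarily small generic local translations *)

Section Scales.
Variables (R : realType) (f : homeo R).
Local Notation L := (generated_subgroup (F_PSL2Z R `|` [set f])).
Local Notation realized := (realized f).
Local Notation local_translation := (local_translation f).
Implicit Types (u v : R).

(** With U the translation by 1/q, U V U sends t to -1/(q^2 t), where V, the map
t |-> t / (1 - q t), is the conjugate of the translation by q under inversion. A
last inversion gives q^2 t. On positive t none of the partial maps meets a pole. *)
Lemma realized_dilation (q : nat) u v : (0 < q)%N -> local_translation (q%:R^-1) ->
  0 < u -> realized (fun t => q%:R ^+ 2 * t) u v.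
Proof.
move=> q0 hq u0; pose w := Num.max v (u + 1).
have uw : u < w by rewrite lt_max; apply/orP; right; lra.
apply: (@realized_sub _ _ _ u w) => //; first by rewrite le_max lexx.
have w0 : 0 < w by lra.
pose Q : R := q%:R; have Q0 : 0 < Q by rewrite ltr0n.
have nQ : Q != 0 by apply: lt0r_neq0.
have hQ : local_translation Q by have := local_translation_int f q.
pose neg (t : R) := - t^-1; pose shift (c t : R) := t + c.
pose phi1 := neg \o shift Q^-1; pose phi2 := shift Q \o phi1.
pose phi3 := shift Q^-1 \o (neg \o phi2).
have e2 t : 0 < t -> phi2 t = Q ^+ 2 * t / (Q * t + 1).
  move=> t0; have Qt : 0 < Q * t by apply: mulr_gt0.
  have nd : Q * t + 1 != 0 by apply: lt0r_neq0; lra.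
  rewrite /phi2 /phi1 /neg /shift /=.
  have -> : t + Q^-1 = (Q * t + 1) / Q by field.
  by rewrite invf_div; field.
have e3 t : 0 < t -> phi3 t = - (Q ^+ 2 * t)^-1.
  move=> t0; have Qt : 0 < Q * t by apply: mulr_gt0.
  have nt : t != 0 by apply: lt0r_neq0.
  have nd : Q * t + 1 != 0 by apply: lt0r_neq0; lra.
  rewrite /phi3 /= e2// /neg /shift invf_div.
  by field; rewrite nt nQ.
have pos2 t : 0 < t -> 0 < phi2 t.
  move=> t0; rewrite e2//; have Qt : 0 < Q * t by apply: mulr_gt0.
  by apply: divr_gt0; [apply: mulr_gt0 => //; apply: exprn_gt0|lra].
have neg_lt (s t : R) : 0 < s * t -> s < t -> neg s < neg t.
  move=> st0 st; rewrite -subr_gt0 /neg.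
  have ns : s != 0 by apply: contraTneq st0 => ->; rewrite mul0r ltxx.
  have nt : t != 0 by apply: contraTneq st0 => ->; rewrite mulr0 ltxx.
  have -> : - t^-1 - - s^-1 = (t - s) / (s * t) by field; rewrite ns nt.
  by rewrite divr_gt0// subr_gt0.
have QV : 0 < Q^-1 by rewrite invr_gt0.
have lt1 : phi1 u < phi1 w.
  by apply: neg_lt; [apply: mulr_gt0|]; rewrite /shift; lra.
have lt2 : phi2 u < phi2 w by rewrite /phi2 /= /shift; lra.
have lt2' : neg (phi2 u) < neg (phi2 w).
  by apply: neg_lt => //; apply: mulr_gt0; exact: pos2.
have lt3 : phi3 u < phi3 w by rewrite /phi3 /= /shift; lra.
apply: (@realized_ext _ _ (neg \o phi3)) => [t /andP[ut tw]|].
  by rewrite /= e3 /neg; [rewrite invrN opprK invrK|lra].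
apply: realized_comp => //; last first.
  apply: realized_inversion_neg; rewrite e3// oppr_lt0 invr_gt0.
  by apply: mulr_gt0 => //; apply: exprn_gt0.
apply: (realized_comp uw lt2' _ (hq _ _)).
apply: (realized_comp uw lt2); last by apply: realized_inversion_pos; exact: pos2.
apply: (realized_comp uw lt1 _ (hQ _ _)).
have lt0 : shift Q^-1 u < shift Q^-1 w by rewrite /shift; lra.
apply: (realized_comp uw lt0 (hq _ _)).
by apply: realized_inversion_pos; rewrite /shift; lra.
Qed.

(** Conjugating by the dilation divides the step. The integer translation by m first
moves the interval to where the dilation is realized. *)
Lemma local_translation_div (c z : R) : 1 <= c ->
  (forall u v, 0 < u -> realized (fun t => c * t) u v) ->
  0 < z -> local_translation z -> local_translation (z / c).
Proof.
move=> c1 hc z0 hz u v; pose m : int := Num.floor (- u) + 2.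
have um : 1 <= u + m%:~R.
  have := floorD1_gt (- u); rewrite /m !intrD; lra.
have [d Ld dE] := hc 1 (v + m%:~R + z / c) ltr01.
have [g Lg gE] := hz (c * (u + m%:~R)) (c * (v + m%:~R)).
have [h Lh hE] := local_translation_int f m u v.
have [k Lk kE] := local_translation_int f (- m) (u + m%:~R + z / c) (v + m%:~R + z / c).
have c0 : 0 < c by lra.
have zc : 0 < z / c by apply: divr_gt0.
exists (k * (d^-1 * (g * (d * h))))%g.
  by apply: genM => //; apply: genM; [exact: genV|do 2![apply: genM => //]].
move=> t /andP[ut tv].
rewrite -[LHS]/(k (homeo_inv d (g (d (h t))))) hE ?ut// dE; last by apply/andP; split; lra.
rewrite gE; last by rewrite !ler_pM2l// !lerD2r ut.
have -> : c * (t + m%:~R) + z = d (t + m%:~R + z / c).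
  rewrite dE; last by apply/andP; split; lra.
  by rewrite [RHS]mulrDr [c * (z / c)]mulrC divfK// lt0r_neq0.
rewrite homeo_funK kE; last by rewrite !lerD2r ut.
by rewrite intrN; ring.
Qed.

Variables (a r : R).
Hypotheses (hf : forall t, f t = a * t + r) (a0 : 0 < a).

Lemma finvE t : homeo_inv f t = a^-1 * (t - r).
Proof.
by apply: (can_inj (@homeo_funK _ f)); rewrite homeo_invK hf mulrA divff ?mul1r ?subrK// lt0r_neq0.
Qed.

Let Lf : L f. Proof. by apply: gen_sub; right. Qed.

Lemma local_translation_scale z : local_translation z -> local_translation (a * z).
Proof.
move=> hz u v; have [g Lg gE] := hz (homeo_inv f u) (homeo_inv f v).
exists (f * (g * f^-1))%g; first by apply: genM => //; apply: genM => //; exact: genV.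
move=> t /andP[ut tv]; rewrite -[LHS]/(f (g (homeo_inv f t))) gE; last first.
  by rewrite !finvE !ler_pM2l ?invr_gt0// !lerD2r ut.
by rewrite hf mulrDr addrAC -hf homeo_invK.
Qed.

Lemma local_translation_unscale z : local_translation z -> local_translation (a^-1 * z).
Proof.
move=> hz u v; have [g Lg gE] := hz (f u) (f v).
exists (f^-1 * (g * f))%g; first by apply: genM; [exact: genV|apply: genM].
move=> t /andP[ut tv]; rewrite -[LHS]/(homeo_inv f (g (f t))) gE; last first.
  by rewrite !hf !lerD2r !ler_pM2l// ut.
by rewrite finvE hf addrAC addrK mulrDr mulKf// lt0r_neq0.
Qed.

(* Bernoulli's inequality for 1 / y. *)
Let small_expr (y : R) : 0 < y < 1 -> exists n, y ^+ n.+1 <= 1 / 200.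
Proof.
move=> /andP[y0 y1]; pose d := y^-1 - 1.
have yd : y * (1 + d) = 1 by rewrite /d addrCA subrr addr0 divff// lt0r_neq0.
have d0 : 0 < d by rewrite subr_gt0 invf_gt1.
have bern n : (1 + n%:R * d) * y ^+ n <= 1.
  elim: n => [|n IH]; first by rewrite expr0; lra.
  apply: le_trans IH; rewrite exprS mulrA; apply: ler_wpM2r; first exact/exprn_ge0/ltW.
  have -> : 1 + n%:R * d = (1 + n%:R * d) * (1 + d) * y.
    by rewrite -mulrA [(1 + d) * y]mulrC yd mulr1.
  apply: ler_wpM2r; first exact: ltW.
  rewrite -subr_ge0 -natr1.
  have -> : (1 + n%:R * d) * (1 + d) - (1 + (n%:R + 1) * d) = n%:R * (d * d) by ring.
  by rewrite !mulr_ge0// ltW.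
pose n := Num.truncn (200 / d); exists n.
have : 200 < n.+1%:R * d by rewrite -ltr_pdivrMr// truncnS_gt.
move=> nd; rewrite ler_pdivlMr// mulrC; apply: le_trans (bern n.+1).
by apply: ler_wpM2r; [exact/exprn_ge0/ltW|lra].
Qed.

Lemma small_generic_irrational t : irrational t -> local_translation t ->
  exists z, [/\ 0 < z, z <= 1 / 200, generic z & local_translation z].
Proof.
move=> irr ht; have [|m [n [/andP[z0 z1] gz]]] := lincomb_small_generic irr (eps := 1 / 200).
  lra.
exists (m%:~R + n%:~R * t); split=> //; first exact: ltW.
by apply: local_translationD; [exact: local_translation_int|exact: local_translationMz].
Qed.

(** For a <> 1 conjugating by f multiplies and divides steps by a, which gives the
step a itself if it is irrational and small rational steps otherwise. For a = 1
the step is r, and if r is rational the dilations by the square of its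
denominator make it small; this denominator exceeds 1 because r is not an
integer. *)
Lemma small_generic_translation : (a = 1 -> r \isn't a Num.int) ->
  exists z, [/\ 0 < z, z <= 1 / 200, generic z & local_translation z].
Proof.
move=> hr; have [a1|a1] := eqVneq a 1; last first.
  have ha : local_translation a.
    by rewrite -[a]mulr1; apply: local_translation_scale; exact: local_translation1.
  have [irr|/existsNP[y /contrapT ay]] := pselect (irrational a).
    exact: small_generic_irrational ha.
  have [w [w0 w1 wn]] : exists w : rat, [/\ 0 < w, w < 1 &
      forall n, local_translation (ratr w ^+ n)].
    have [lt|gt|//] := ltgtP a 1; last by move=> e; rewrite e eqxx in a1.
      exists y; split; [by rewrite -(ltr0q R) -ay|by rewrite -(ltr_rat R) rmorph1 -ay|].
      rewrite -ay.
      elim=> [|n IH]; first by rewrite expr0; exact: local_translation1.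
      by rewrite exprS; exact: local_translation_scale.
    have yV : ratr y^-1 = a^-1 :> R by rewrite fmorphV ay.
    exists y^-1; split.
    - by rewrite -(ltr0q R) yV invr_gt0.
    - by rewrite -(ltr_rat R) rmorph1 yV invf_lt1.
    rewrite yV.
    elim=> [|n IH]; first by rewrite expr0; exact: local_translation1.
    by rewrite exprS; exact: local_translation_unscale.
  have w01 : 0 < (ratr w : R) < 1 by rewrite ltr0q w0 -[1](rmorph1 (@ratr R)) ltr_rat.
  have [n le] := small_expr w01; exists (ratr w ^+ n.+1); split=> //.
    by rewrite exprn_gt0// ltr0q.
  by rewrite -rmorphXn; apply: generic_rat; rewrite exprn_gt0//= exprn_ilt1// ltW.
have hr' : local_translation r.
  by move=> u v; exists f => // t _; rewrite hf a1 mul1r.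
have [irr|/existsNP[y /contrapT ry]] := pselect (irrational r).
  exact: small_generic_irrational hr'.
have dy : (1 < denq y)%R.
  rewrite lt_neqAle eq_sym; apply/andP; split; last by have := denq_gt0 y; lia.
  apply: contra (hr a1) => /eqP dy; rewrite ry -[y]divq_num_den dy divr1 ratr_int.
  exact: intr_int.
have [q qE] : exists q : nat, denq y = q by exists `|denq y|%N; rewrite gez0_abs//; lia.
have q1 : (1 < q)%N by move: dy; rewrite qE; lia.
have Q0 : 0 < (q%:R : R) by rewrite ltr0n; lia.
have hq : local_translation q%:R^-1.
  have [u [v e]] := Bezoutz (numq y) (denq y).
  have {}e : u * numq y + v * denq y = 1 by rewrite e /gcdz (eqP (coprime_num_den y)).
  have -> : q%:R^-1 = v%:~R + u%:~R * r :> R.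
    have rE : r = (numq y)%:~R / q%:R.
      by rewrite ry -[in LHS](divq_num_den y) qE rmorphM fmorphV /= !ratr_int.
    apply: (mulIf (lt0r_neq0 Q0)); rewrite mulVf ?lt0r_neq0// rE.
    rewrite mulrDl -[RHS]addrC -!mulrA mulVf ?lt0r_neq0// mulr1.
    by have := congr1 (intr : int -> R) e; rewrite qE intrD !intrM => ->.
  by apply: local_translationD; [exact: local_translation_int|exact: local_translationMz].
have hqk k : local_translation (q%:R^-1 / (q%:R ^+ 2) ^+ k).
  elim: k => [|k IH]; first by rewrite expr0 divr1.
  rewrite exprSr invfM mulrA; apply: local_translation_div => //.
  - by apply: exprn_ege1; rewrite ler1n; lia.
  - by move=> u v u0; apply: realized_dilation => //; lia.
  - by rewrite divr_gt0 ?invr_gt0 ?exprn_gt0.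
(* This is q^-201, and q^201 >= 2^201 > 200. *)
exists (q%:R^-1 / (q%:R ^+ 2) ^+ 100); split=> //.
- by rewrite divr_gt0 ?invr_gt0 ?exprn_gt0.
- rewrite -invfM -exprM -exprS div1r lef_pV2 ?posrE ?exprn_gt0// -natrX ler_nat.
  by apply: leq_trans (ltnW (ltn_expl _ q1)).
- have -> : q%:R^-1 / (q%:R ^+ 2) ^+ 100 = ratr ((q%:R ^+ 201)^-1) :> R.
    by rewrite fmorphV rmorphXn /= ratr_nat -invfM -exprM -exprS.
  apply: generic_rat; rewrite invr_gt0 exprn_gt0 ?ltr0n//=; last lia.
  by rewrite invf_lt1 ?exprn_gt0 ?ltr0n ?exprn_egt1 ?ltr1n//; lia.
Qed.

End Scales.

(** * From expansion to a paradoxical decomposition *)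

(** The piece of h = Phi (g, c) is given by c and by the factor h g^-1 when c is 0
or 1. The elements Phi (tau k, 2) lie outside these images and are distributed
one to each piece; any other element goes to the first piece. Enlarging a piece
keeps its translates inside the group, so the two coverings are not affected. *)
Lemma paradoxical_of_injection (G : groupType) (A : set G) (K : finType) (k0 : K)
    (sigma : K -> G) (Phi : G * 'I_3 -> G) (n m : nat) (tau : 'I_n.+1 + 'I_m.+1 -> G) :
  (#|K| <= n.+1)%N -> (#|K| <= m.+1)%N ->
  (forall k, generated_subgroup A (sigma k)) -> (forall k, generated_subgroup A (tau k)) ->
  injective tau -> injective Phi -> (forall p, exists k, Phi p = (sigma k * p.1)%g) ->
  has_paradoxical_decomposition (generated_subgroup A) (n.+1 + m.+1).
Proof.
set L := generated_subgroup A => Kn Km Ls Lt taui Phii /choice[kap kapE].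
pose rk p := index (kap p) (enum K).
have rkK p : (rk p < #|K|)%N by rewrite cardE index_mem mem_enum.
pose code (p : G * 'I_3) : 'I_n.+1 + 'I_m.+1 :=
  if val p.2 == 0%N then inl (inord (rk p)) else
  if val p.2 == 1%N then inr (inord (rk p)) else
  odflt (inl ord0) [pick k | tau k == p.1].
pose owner h := if pselect (exists p, Phi p = h) is left e then code (projT1 (cid e))
  else inl ord0.
have ownerE p : owner (Phi p) = code p.
  rewrite /owner; case: pselect => [e|[]]; last by exists p.
  by congr code; apply: Phii; case: cid.
pose el N (k : 'I_N.+1) := (sigma (nth k0 (enum K) k))^-1%g.
have Lel N (k : 'I_N.+1) : L (el N k) by apply: genV; exact: Ls.
have elE N p : (#|K| <= N.+1)%N -> (el N (inord (rk p)) * Phi p)%g = p.1.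
  move=> KN; rewrite /el inordK ?(leq_trans (rkK p))// nth_index ?mem_enum//.
  by rewrite kapE mulKg.
have LPhi p : L p.1 -> L (Phi p) by move=> Lp; rewrite kapE; exact: genM (Ls _) Lp.
pose S i := [set h | L h /\ owner h = inl i].
pose T j := [set h | L h /\ owner h = inr j].
have owner_tau k : owner (Phi (tau k, Ordinal (isT : 2 < 3)%N)) = k.
  rewrite ownerE /code /=; case: pickP => [k' /eqP/taui//|/(_ k)].
  by rewrite eqxx.
exists n.+1, m.+1, S, T, (el n), (el m); split; first by [].
split; [|by split=> k; exact: Lel| |].
- split.
  + apply/seteqP; split=> [h|h Lh]; first by case=> -[i|j] _ [].
    by case E : (owner h) => [i|j]; [exists (inl i)|exists (inr j)].
  + by move=> [i|j] [i'|j'] _ _ [h [[_ e] [_ e']]]; congruence.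
  + move=> k _; exists (Phi (tau k, Ordinal (isT : 2 < 3)%N)).
    by case: k => k; (split; [apply: LPhi; exact: Lt|exact: owner_tau]).
- apply/seteqP; split=> [g Lg|_ [i _ [h [Lh _] <-]]]; last exact: genM (Lel _ _) Lh.
  exists (inord (rk (g, Ordinal (isT : 0 < 3)%N))) => //.
  exists (Phi (g, Ordinal (isT : 0 < 3)%N)); last exact: elE.
  by split; [exact: LPhi|rewrite ownerE].
- apply/seteqP; split=> [g Lg|_ [i _ [h [Lh _] <-]]]; last exact: genM (Lel _ _) Lh.
  exists (inord (rk (g, Ordinal (isT : 1 < 3)%N))) => //.
  exists (Phi (g, Ordinal (isT : 1 < 3)%N)); last exact: elE.
  by split; [exact: LPhi|rewrite ownerE].
Qed.

(** Applying the expansion twice multiplies sizes by at least (7/4)^2 = 49/16 > 3,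
which is Hall's condition for three copies of the group. *)
Lemma tripling_injection (R : realType) (x : cusp -> homeo R) :
  (forall A B : seq (homeo R), uniq A -> uniq B ->
    (forall g i, g \in A -> (x i * g)%g \in B) -> (7 * size A <= 4 * size B)%N) ->
  exists2 Phi : homeo R * 'I_3 -> homeo R, injective Phi &
    forall p, exists k : cusp * cusp, Phi p = (x k.1 * x k.2 * p.1)%g.
Proof.
move=> expand.
pose X (p : homeo R * 'I_3) : {fset homeo R} :=
  [fset h in [seq (x k.1 * x k.2 * p.1)%g | k <- enum {: cusp * cusp}]]%fset.
have XP p h : reflect (exists k : cusp * cusp, h = (x k.1 * x k.2 * p.1)%g) (h \in X p).
  rewrite !inE; apply: (iffP mapP) => [[k _ ->]|[k ->]]; exists k => //.
  by rewrite mem_enum.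
have [A|Phi Phii PhiX] := @hall_marriage _ _ X; last first.
  by exists Phi => // p; apply/XP.
pose next (B : seq (homeo R)) := undup [seq (x i * g)%g | i <- enum {: cusp}, g <- B].
have nextP B g i : g \in B -> (x i * g)%g \in next B.
  by move=> gB; rewrite mem_undup; apply/allpairsP; exists (i, g); rewrite mem_enum.
pose A1 := undup [seq p.1 | p <- enum_fset A].
have u1 : uniq A1 by exact: undup_uniq.
have cA : (#|` A| <= 3 * size A1)%N.
  have <- : size [seq (g, c) | g <- A1, c <- enum 'I_3] = (3 * size A1)%N.
    by rewrite size_allpairs size_enum_ord mulnC.
  apply: uniq_leq_size; first exact: fset_uniq.
  move=> [g c] pA; apply/allpairsP; exists (g, c); rewrite mem_enum; split=> //=.
  by rewrite mem_undup; apply/mapP; exists (g, c).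
have e1 := expand A1 (next A1) u1 (undup_uniq _) (fun g i => @nextP A1 g i).
have e2 := expand _ (next (next A1)) (undup_uniq _) (undup_uniq _) (fun g i => @nextP (next A1) g i).
have cX : (size (next (next A1)) <= #|` \bigcup_(p <- A) X p|%fset)%N.
  apply: uniq_leq_size; first exact: undup_uniq.
  move=> h; rewrite mem_undup => /allpairsP[[i g] /= [_ + ->]].
  rewrite mem_undup => /allpairsP[[j g'] /= [_ + ->]].
  rewrite mem_undup => /mapP[p pA ->].
  apply/bigfcupP; exists p; first by rewrite andbT.
  by apply/XP; exists (i, j); rewrite mulgA.
apply: leq_trans cA (leq_trans _ cX).
by move: e1 e2; move: (size A1) (size (next A1)) (size (next (next A1))) => i j k; lia.
Qed.

Theorem theorem0p2 (R : realType) (a r : R) (f : homeo R)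
    (hf : forall t : R, f t = a * t + r)
    (ha : 0 < a)
    (hr : a = 1 -> r \isn't a Num.int) :
  has_paradoxical_decomposition
    (generated_subgroup (F_PSL2Z R `|` [set f])) 25.
Proof.
have [z [z0 zs gz hz]] := small_generic_translation hf ha hr.
have [x [Lx xE]] := realized_parabolics z0 zs hz.
have [Phi Phii PhiE] := tripling_injection (translates_expand z0 zs gz xE).
have [T TE] := @affine_homeo_exists R 1 1 ltr01.
have TXE k t : (T ^+ k)%g t = t + k%:R.
  elim: k t => [|k IH] t; first by rewrite addr0.
  by rewrite expgS -[LHS]/(T ((T ^+ k)%g t)) IH TE -natr1; ring.
pose tau (k : 'I_12 + 'I_13) := (T ^+ match k with inl i => val i | inr j => 12 + j end)%g.
apply: (@paradoxical_of_injection _ _ _ (None, None)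
  (fun k : cusp * cusp => (x k.1 * x k.2)%g) Phi 11 12 tau) => //.
- by rewrite card_prod card_option card_bool.
- by rewrite card_prod card_option card_bool.
- by move=> k; apply: genM.
- move=> k; have LT : generated_subgroup (F_PSL2Z R `|` [set f]) T.
    by apply: gen_sub; left; apply: translation_in_F.
  rewrite /tau; elim: (match k with inl i => _ | inr j => _ end) => [|j IH]; first exact: gen1.
  by rewrite expgS; exact: genM.
- move=> k k' /(congr1 (fun g : homeo R => g 0)); rewrite !TXE !add0r => /eqP.
  rewrite eqr_nat => /eqP; case: k k' => [i|j] [i'|j'] e.
  + by congr inl; exact: val_inj.
  + by have := ltn_ord i; move: e => /= ->; rewrite ltnNge leq_addr.
  + by have := ltn_ord i'; move: e => /= <-; rewrite ltnNge leq_addr.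
  + by congr inr; apply: val_inj; move: e => /= /addnI.
Qed.
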